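(* In the V-trace setting of the context, assume $|\mathcal S|\ge2$, let $\gamma$ be the contraction factor and $A$ the noise constant described in the context, and let $\epsilon_k=\frac{\epsilon}{k+K}$ with $\epsilon=\frac{4}{1-\gamma}$ and $K=\frac{64(A+2)\log|\mathcal S|}{(1-\gamma)^3}$. Then for all $k\ge0$, $$\mathbb{E}[\|V_k-V_{\pi_{\bar\rho}}\|_\infty^2]\le1024e^2\big(\|V_0-V_{\pi_{\bar\rho}}\|_\infty^2+2\|V_{\pi_{\bar\rho}}\|_\infty^2+1\big)\frac{(A+2)\log|\mathcal S|}{(1-\gamma)^3}\frac{1}{k+K}.$$
   Context: Finite MDP: finite state space $\mathcal S$, finite action space $\mathcal A$, transition matrices $P_a(s,s')$, reward $\mathcal R:\mathcal S\times\mathcal A\to[0,1]$, discount $\beta\in(0,1)$. A policy $\pi$ gives probabilities $\pi(a|s)$; its value function is $V_\pi(s)=\mathbb{E}_\pi[\sum_{k\ge0}\beta^k\mathcal R(S_k,A_k)\mid S_0=s]$. Let $\pi$ (target) and $\pi'$ (behavior) be policies with $\{a:\pi(a|s)>0\}\subseteq\{a:\pi'(a|s)>0\}$ for all $s$. Fix truncation levels $\bar\rho\ge\bar c>0$ and horizon $n\ge1$. For a trajectory under $\pi'$, $c_t=\min(\bar c,\pi(A_t|S_t)/\pi'(A_t|S_t))$, $\rho_t=\min(\bar\rho,\pi(A_t|S_t)/\pi'(A_t|S_t))$, empty products equal $1$. The V-trace algorithm: given deterministic $V_0$ and stepsizes $\epsilon_k$, at each iteration $k$, for each $s$ a fresh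 trajectory $S_0^s=s,A_0^s,\dots,S_n^s$ is generated under $\pi'$ (independently of the past given the current iterate), with weights $c_t^s,\rho_t^s$, and $V_{k+1}(s)=V_k(s)+\epsilon_k\sum_{t=0}^{n-1}\beta^t(\prod_{j=0}^{t-1}c_j^s)\rho_t^s(\mathcal R(S_t^s,A_t^s)+\beta V_k(S_{t+1}^s)-V_k(S_t^s))$. Let $\kappa_c=\min_s\mathbb{E}_{\pi'}[c_0\mid S_0=s]$, $\kappa_\rho=\min_s\mathbb{E}_{\pi'}[\rho_0\mid S_0=s]$, $\gamma=1-\frac{(1-\beta)(1-(\beta\kappa_c)^n)\kappa_\rho}{1-\beta\kappa_c}$. Let $A=\frac{32\bar\rho^2}{(1-\beta\bar c)^2}$ if $\beta\bar c<1$, $A=32\bar\rho^2n^2$ if $\beta\bar c=1$, $A=\frac{32\bar\rho^2(\beta\bar c)^{2n}}{(\beta\bar c-1)^2}$ if $\beta\bar c>1$. Let $\pi_{\bar\rho}(a|s)=\frac{\min(\bar\rho\pi'(a|s),\pi(a|s))}{\sum_b\min(\bar\rho\pi'(b|s),\pi(b|s))}$ and $V_{\pi_{\bar\rho}}$ its value function. *)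

(* Defs.v *)
From mathcomp Require Import ssreflect ssrfun ssrbool eqtype ssrnat seq choice fintype finfun bigop tuple.
From Stdlib Require Import Reals.

Set Implicit Arguments.
Unset Strict Implicit.
Unset Printing Implicit Defensive.

Local Open Scope R_scope.

Section VTrace.
Variables (S Act : finType).

Definition is_policy (pol : S -> Act -> R) : Prop :=
  (forall s a, 0 <= pol s a) /\ (forall s, \big[Rplus/0]_(a : Act) pol s a = 1).

Definition is_transition (P : Act -> S -> S -> R) : Prop :=
  (forall a s s', 0 <= P a s s') /\
  (forall a s, \big[Rplus/0]_(s' : S) P a s s' = 1).

Fixpoint state_dist (P : Act -> S -> S -> R) (pol : S -> Act -> R) (s0 : S)
    (k : nat) : S -> R :=
  match k with
  | O => fun s => if s == s0 then 1 else 0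
  | k'.+1 => fun s' => \big[Rplus/0]_(s : S) \big[Rplus/0]_(a : Act)
                 (state_dist P pol s0 k' s * pol s a * P a s s')
  end.

Definition exp_reward (P : Act -> S -> S -> R) (Rw : S -> Act -> R)
    (pol : S -> Act -> R) (s0 : S) (k : nat) : R :=
  \big[Rplus/0]_(s : S) \big[Rplus/0]_(a : Act)
     (state_dist P pol s0 k s * pol s a * Rw s a).

Definition is_value_function (P : Act -> S -> S -> R) (Rw : S -> Act -> R)
    (beta : R) (pol : S -> Act -> R) (V : S -> R) : Prop :=
  forall s, Un_cv (fun N => sum_f_R0 (fun k => beta ^ k * exp_reward P Rw pol s k) N) (V s).

Definition pi_trunc (pi pi' : S -> Act -> R) (rhobar : R) : S -> Act -> R :=
  fun s a => Rmin (rhobar * pi' s a) (pi s a) /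
             \big[Rplus/0]_(b : Act) Rmin (rhobar * pi' s b) (pi s b).

Definition ratio (pi pi' : S -> Act -> R) (s : S) (a : Act) : R := pi s a / pi' s a.

Definition exp_trunc_ratio (pi pi' : S -> Act -> R) (tr : R) (s : S) : R :=
  \big[Rplus/0]_(a : Act) (pi' s a * Rmin tr (ratio pi pi' s a)).

Definition is_min_over_states (f : S -> R) (m : R) : Prop :=
  (forall s, m <= f s) /\ (exists s, m = f s).

Definition gamma_factor (beta kc krho : R) (n : nat) : R :=
  1 - (1 - beta) * (1 - (beta * kc) ^ n) * krho / (1 - beta * kc).

Definition noise_const (beta cbar rhobar : R) (n : nat) : R :=
  if Rlt_dec (beta * cbar) 1 then 32 * rhobar ^ 2 / (1 - beta * cbar) ^ 2
  else if Req_EM_T (beta * cbar) 1 then 32 * rhobar ^ 2 * (INR n) ^ 2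
  else 32 * rhobar ^ 2 * (beta * cbar) ^ (2 * n) / (beta * cbar - 1) ^ 2.

(* A trajectory of horizon n started at s: actions A_0..A_{n-1} and the
   successor states S_1..S_n (S_0 = s). *)
Definition traj (n : nat) : finType := (n.-tuple Act * n.-tuple S)%type.

Definition st (n : nat) (s : S) (tr : traj n) (t : nat) : S :=
  if t is t'.+1 then nth s (tval tr.2) t' else s.

Definition act (n : nat) (tr : traj n) (t : 'I_n) : Act := tnth tr.1 t.

Definition traj_prob (P : Act -> S -> S -> R) (pi' : S -> Act -> R)
    (n : nat) (s : S) (tr : traj n) : R :=
  \big[Rmult/1]_(t < n)
     (pi' (st s tr t) (act tr t) * P (act tr t) (st s tr t) (st s tr t.+1)).

Definition vtrace_target (P : Act -> S -> S -> R) (Rw : S -> Act -> R)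
    (pi pi' : S -> Act -> R) (beta cbar rhobar : R) (n : nat)
    (V : S -> R) (s : S) (tr : traj n) : R :=
  \big[Rplus/0]_(t < n)
    (beta ^ t *
     (\big[Rmult/1]_(j < n | (j < t)%nat)
         Rmin cbar (ratio pi pi' (st s tr j) (act tr j))) *
     Rmin rhobar (ratio pi pi' (st s tr t) (act tr t)) *
     (Rw (st s tr t) (act tr t) + beta * V (st s tr t.+1) - V (st s tr t))).

(* expectation of g(V_{k+1}) given V_k = V, with stepsize eps_k;
   one independent trajectory per state *)
Definition step_exp (P : Act -> S -> S -> R) (Rw : S -> Act -> R)
    (pi pi' : S -> Act -> R) (beta cbar rhobar : R) (n : nat)
    (epsk : R) (V : S -> R) (g : (S -> R) -> R) : R :=
  \big[Rplus/0]_(om : {ffun S -> traj n})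
    ((\big[Rmult/1]_(s : S) traj_prob P pi' s (om s)) *
     g (fun s => V s + epsk * vtrace_target P Rw pi pi' beta cbar rhobar V s (om s))).

(* E[ g(V_k) ] for the V-trace iterates started at deterministic V0 *)
Fixpoint vtrace_exp (P : Act -> S -> S -> R) (Rw : S -> Act -> R)
    (pi pi' : S -> Act -> R) (beta cbar rhobar : R) (n : nat)
    (eps : nat -> R) (V0 : S -> R) (k : nat) (g : (S -> R) -> R) : R :=
  match k with
  | O => g V0
  | k'.+1 => vtrace_exp P Rw pi pi' beta cbar rhobar n eps V0 k'
               (fun V => step_exp P Rw pi pi' beta cbar rhobar n (eps k') V g)
  end.

Definition sup_norm (f : S -> R) : R := \big[Rmax/0]_(s : S) Rabs (f s).

End VTrace.

(* Main.v *)
Require Import Defs.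
From HB Require Import structures.
From mathcomp Require Import ssreflect ssrfun ssrbool eqtype ssrnat seq choice fintype finfun bigop tuple.
From Stdlib Require Import Reals Lra Psatz.

Set Implicit Arguments.
Unset Strict Implicit.
Unset Printing Implicit Defensive.
Local Open Scope R_scope.

(** The Lyapunov function is the squared p-norm of [V_k - V*], [V* = Vrho], with p the even
    integer just above [4 ln|S| / (1 - gamma)]; it replaces the Moreau envelope
    of the sup norm.  For this p the norm of the constant vector 1 is
    [D = |S|^(1/p) <= e^((1-gamma)/4)], so the expected V-trace update, which
    contracts the sup norm by [gamma], still contracts the p-norm by
    [gamma D < 1].  For centred noise [h] with [|h| <= H] almost surely,
    [E ||u + h||^2 <= ||u||^2 + 3 p D^2 H^2].  With the noise bound
    [H^2 = O(eps_k^2 A (1 + ||V_k||^2))] this gives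
    [Z_{k+1} <= (1 - 3 / (2 (k + K))) Z_k + O(1 / (k + K)^2)] for
    [Z_k = E ||V_k - V*||_p^2], hence [Z_k = O(1 / (k + K))] by induction. *)

(** * Finite sums and powers of real numbers *)

(** The squared sup norm has kinks, so one step of it does not let centred noise cancel to first
    order. An even [p] makes the p-th power of the norm a polynomial in the coordinates, and the
    linear term of its expansion has mean zero. The size of [p] is a compromise. [D] must be close
    enough to 1 to leave a contraction, which wants a large [p], while the noise enters with the
    factor [p D^2]. Taking [p] of order [ln|S| / (1 - gamma)] produces the logarithm; together with
    the squared stepsize, of order [1 / ((1 - gamma) (k + K))^2], it also produces the cube of
    [1 - gamma] in the rate. No bound on the iterates is known in advance, so part of the noise is
    proportional to [Z_k] itself and competes with the drift. The offset [K] settles this: it keeps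
    [eps_k p A] of order [1 - gamma], small enough for the drift to win. The drift coefficient 3/2
    has to exceed 1 for a rate [1 / (k + K)], and the excess 1/2 pays for the remaining noise. *)

Fact RplusA : associative Rplus. Proof. by move=> x y z; lra. Qed.
Fact RplusC : commutative Rplus. Proof. by move=> x y; lra. Qed.
Fact Rplus0x : left_id 0 Rplus. Proof. by move=> x; lra. Qed.
HB.instance Definition _ := Monoid.isComLaw.Build R 0 Rplus RplusA RplusC Rplus0x.
Fact RmultA : associative Rmult. Proof. by move=> x y z; lra. Qed.
Fact RmultC : commutative Rmult. Proof. by move=> x y; lra. Qed.
Fact Rmult1x : left_id 1 Rmult. Proof. by move=> x; lra. Qed.
HB.instance Definition _ := Monoid.isComLaw.Build R 1 Rmult RmultA RmultC Rmult1x.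
Fact Rmult0x : left_zero 0 Rmult. Proof. by move=> x; lra. Qed.
Fact Rmultx0 : right_zero 0 Rmult. Proof. by move=> x; lra. Qed.
HB.instance Definition _ := Monoid.isMulLaw.Build R 0 Rmult Rmult0x Rmultx0.
Fact RmultDl : left_distributive Rmult Rplus. Proof. by move=> x y z; lra. Qed.
Fact RmultDr : right_distributive Rmult Rplus. Proof. by move=> x y z; lra. Qed.
HB.instance Definition _ := Monoid.isAddLaw.Build R Rmult Rplus RmultDl RmultDr.

Section FiniteSums.
Variable I : finType.
Implicit Types F G : I -> R.

Lemma rsum_le F G : (forall i, F i <= G i) ->
  \big[Rplus/0]_(i : I) F i <= \big[Rplus/0]_(i : I) G i.
Proof.
move=> le_FG; apply: (big_ind2 (fun x y => x <= y)) => //; first lra.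
by move=> *; lra.
Qed.

Lemma rsum_ge0 F : (forall i, 0 <= F i) -> 0 <= \big[Rplus/0]_(i : I) F i.
Proof. by move=> F0; apply: big_ind => //; [lra | move=> *; lra]. Qed.

Lemma rsum_ge_term F i : (forall j, 0 <= F j) ->
  F i <= \big[Rplus/0]_(j : I) F j.
Proof.
move=> F0; rewrite (bigD1 i) //=.
suff: 0 <= \big[Rplus/0]_(j | j != i) F j by lra.
by apply: big_ind => //; [lra | move=> *; lra].
Qed.

Lemma rsum_mull x F :
  \big[Rplus/0]_(i : I) (x * F i) = x * \big[Rplus/0]_(i : I) F i.
Proof. by rewrite big_distrr. Qed.

Lemma rsum_mulr x F :
  \big[Rplus/0]_(i : I) (F i * x) = (\big[Rplus/0]_(i : I) F i) * x.
Proof. by rewrite big_distrl. Qed.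

Lemma rsumD F G : \big[Rplus/0]_(i : I) (F i + G i) =
  \big[Rplus/0]_(i : I) F i + \big[Rplus/0]_(i : I) G i.
Proof. by rewrite big_split. Qed.

Lemma rsumB F G : \big[Rplus/0]_(i : I) (F i - G i) =
  \big[Rplus/0]_(i : I) F i - \big[Rplus/0]_(i : I) G i.
Proof.
have -> : \big[Rplus/0]_(i : I) (F i - G i) =
    \big[Rplus/0]_(i : I) (F i + (-1) * G i) by apply: eq_bigr => i _; lra.
by rewrite rsumD rsum_mull; lra.
Qed.

Lemma rsum_const x : \big[Rplus/0]_(i : I) x = INR #|I| * x.
Proof.
rewrite big_const; elim: #|I| => [|k IHk]; first by rewrite /=; lra.
by rewrite iterS IHk S_INR; lra.
Qed.

Lemma rsum_abs F :
  Rabs (\big[Rplus/0]_(i : I) F i) <= \big[Rplus/0]_(i : I) Rabs (F i).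
Proof.
apply: (big_ind2 (fun x y => Rabs x <= y)) => //; first by rewrite Rabs_R0; lra.
  by move=> x1 x2 y1 y2 ? ?; have := Rabs_triang x1 y1; lra.
by move=> i _; lra.
Qed.

End FiniteSums.

Section PowerInequalities.

(** Monotonicity of [t ^ k] in product form: the defect in the induction step of each of the next
    three inequalities is a nonnegative multiple of such a product. *)
Lemma pow_diff_sign_ge0 x y k : 0 <= x -> 0 <= y -> 0 <= (x - y) * (x ^ k - y ^ k).
Proof.
move=> x0 y0; case: (Rle_lt_dec x y) => xy.
  by have := pow_incr x y k (conj x0 xy); nra.
by have := pow_incr y x k (conj y0 (Rlt_le _ _ xy)); nra.
Qed.

Lemma bernoulli_ge t k : 0 <= t -> 1 + INR k * (t - 1) <= t ^ k.
Proof.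
move=> t0; elim: k => [|k IHk]; first by rewrite /=; lra.
rewrite S_INR /=; have k0 := pos_INR k.
by have := pow_diff_sign_ge0 k t0 Rle_0_1; rewrite pow1; nra.
Qed.

(** For [k > 0] this is Young's inequality with exponents [(k+1)/k] and [k+1], second factor 1,
    denominators cleared. *)
Lemma young_pow t k : 0 <= t -> INR k.+1 * t ^ k <= INR k * t ^ k.+1 + 1.
Proof.
move=> t0; elim: k => [|k IHk]; first by rewrite /=; lra.
have := pow_diff_sign_ge0 k.+1 t0 Rle_0_1; rewrite pow1 => H.
move: IHk H; rewrite !S_INR /=; have := pow_le t k t0; set q := t ^ k; nra.
Qed.

Lemma pow_convex l x y k : 0 <= l <= 1 -> 0 <= x -> 0 <= y ->
  (l * x + (1 - l) * y) ^ k <= l * x ^ k + (1 - l) * y ^ k.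
Proof.
move=> l01 x0 y0; elim: k => [|k IHk]; first by rewrite /=; lra.
have z0 : 0 <= l * x + (1 - l) * y by nra.
have H1 : (l * x + (1 - l) * y) ^ k.+1 <=
    (l * x + (1 - l) * y) * (l * x ^ k + (1 - l) * y ^ k).
  by rewrite /=; apply: Rmult_le_compat_l.
apply: Rle_trans H1 _.
have H := pow_diff_sign_ge0 k x0 y0.
have H2 : 0 <= l * (1 - l) by nra.
have := Rmult_le_pos _ _ H2 H; rewrite /=; set a := x ^ k; set b := y ^ k; nra.
Qed.

(** The remainders obey [R_{k+1} = (u + h) R_k + (k+2) u^(k+1) h^2], so the bound follows by
    induction without derivatives. *)
Lemma pow_taylor2 u h k :
  Rabs ((u + h) ^ k.+2 - u ^ k.+2 - INR k.+2 * u ^ k.+1 * h) <=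
  INR k.+2 * INR k.+1 / 2 * h ^ 2 * (Rabs u + Rabs h) ^ k.
Proof.
elim: k => [|k IHk].
  have -> : (u + h) ^ 2 - u ^ 2 - INR 2 * u ^ 1 * h = h ^ 2 by rewrite /=; ring.
  by rewrite Rabs_pos_eq /=; nra.
set q := Rabs u + Rabs h.
have q0 : 0 <= q by have := Rabs_pos u; have := Rabs_pos h; rewrite /q; lra.
have -> : (u + h) ^ k.+3 - u ^ k.+3 - INR k.+3 * u ^ k.+2 * h =
   (u + h) * ((u + h) ^ k.+2 - u ^ k.+2 - INR k.+2 * u ^ k.+1 * h)
   + INR k.+2 * u ^ k.+1 * h ^ 2.
  by rewrite !S_INR /=; ring.
apply: Rle_trans (Rabs_triang _ _) _.
have H1 : Rabs ((u + h) * ((u + h) ^ k.+2 - u ^ k.+2 - INR k.+2 * u ^ k.+1 * h))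
    <= q * (INR k.+2 * INR k.+1 / 2 * h ^ 2 * q ^ k).
  rewrite Rabs_mult; apply: Rmult_le_compat; try exact: Rabs_pos.
    exact: Rabs_triang.
  exact: IHk.
have H2 : Rabs (INR k.+2 * u ^ k.+1 * h ^ 2) <= INR k.+2 * q ^ k.+1 * h ^ 2.
  rewrite 2!Rabs_mult (Rabs_pos_eq (INR _)); last exact: pos_INR.
  rewrite (Rabs_pos_eq (h ^ 2)); last by nra.
  apply: Rmult_le_compat_r; first by nra.
  apply: Rmult_le_compat_l; first exact: pos_INR.
  rewrite -RPow_abs; apply: pow_incr; split; first exact: Rabs_pos.
  by have := Rabs_pos h; rewrite /q; lra.
apply: Rle_trans (Rplus_le_compat _ _ _ _ H1 H2) _.
by apply: Req_le; rewrite !S_INR /=; field.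
Qed.

Lemma pow_le_inv x y k : (0 < k)%nat -> 0 <= y -> x ^ k <= y ^ k -> x <= y.
Proof.
case: k => // k _ y0 le_xy; apply: Rnot_lt_le => lt_yx.
have H := pow_incr y x k (conj y0 (Rlt_le _ _ lt_yx)).
have x0 : 0 < x by lra.
have := pow_lt x k x0; move: le_xy => /=; nra.
Qed.

Lemma pow_double x k : x ^ k.*2 = (x ^ 2) ^ k.
Proof. by rewrite -mul2n -multE pow_mult. Qed.

(* [Rpower 0 x] is 1, hence the case distinction. *)
Definition nroot (k : nat) (z : R) : R :=
  if Req_EM_T z 0 then 0 else Rpower z (/ INR k).

Lemma nroot_ge0 k z : 0 <= nroot k z.
Proof.
rewrite /nroot; case: (Req_EM_T z 0) => zE /=; first lra.
by apply: Rlt_le; apply: exp_pos.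
Qed.

Lemma nrootK k z : (0 < k)%nat -> 0 <= z -> nroot k z ^ k = z.
Proof.
case: k => // k _ z0; rewrite /nroot; case: (Req_EM_T z 0) => zE; cbn -[pow INR].
  by rewrite zE pow_i //; apply/ltP.
rewrite -Rpower_pow; last exact: exp_pos.
rewrite Rpower_mult Rinv_l ?Rpower_1 //; first lra.
by apply: not_0_INR.
Qed.

End PowerInequalities.

(** * p-norms on finite-dimensional space *)

Section PNorm.
Variable S : finType.
Implicit Types x y u : S -> R.

Definition pnorm (p : nat) x : R :=
  nroot p (\big[Rplus/0]_(s : S) Rabs (x s) ^ p).

Definition dimroot (p : nat) : R := nroot p (INR #|S|).

Variable p : nat.
Hypothesis p_gt0 : (0 < p)%nat.

Lemma pnorm_ge0 x : 0 <= pnorm p x.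
Proof. exact: nroot_ge0. Qed.

Lemma dimroot_ge0 : 0 <= dimroot p.
Proof. exact: nroot_ge0. Qed.

Lemma pnormK x : pnorm p x ^ p = \big[Rplus/0]_(s : S) Rabs (x s) ^ p.
Proof.
by apply: nrootK => //; apply: rsum_ge0 => s; apply/pow_le/Rabs_pos.
Qed.

Lemma dimrootK : dimroot p ^ p = INR #|S|.
Proof. by apply: nrootK => //; apply: pos_INR. Qed.

Lemma Rabs_le_pnorm x s : Rabs (x s) <= pnorm p x.
Proof.
apply: (pow_le_inv p_gt0 (pnorm_ge0 x)); rewrite pnormK.
by apply: (rsum_ge_term (F := fun s => Rabs (x s) ^ p)) => j; apply/pow_le/Rabs_pos.
Qed.

Lemma pnorm_scale c x : 0 <= c -> pnorm p (fun s => c * x s) = c * pnorm p x.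
Proof.
move=> c0.
have E : pnorm p (fun s => c * x s) ^ p = (c * pnorm p x) ^ p.
  rewrite Rpow_mult_distr !pnormK -rsum_mull; apply: eq_bigr => s _.
  by rewrite Rabs_mult Rpow_mult_distr Rabs_pos_eq.
have N0 := pnorm_ge0 x; have N1 := pnorm_ge0 (fun s => c * x s).
by apply: Rle_antisym; apply: (pow_le_inv p_gt0) => //;
  rewrite ?E; try nra; apply: Rle_refl.
Qed.

(** Convexity of the p-th power: with [T = N + D c], the vector [|a| + c] is [T] times a convex
    combination of [|a| / N] and the constant [1 / D], both of p-norm 1. The cases [N = 0], [c = 0]
    and [D = 0] are split off first, so that the divisions make sense. *)
Lemma rsum_pow_shift a c : 0 <= c ->
  \big[Rplus/0]_(s : S) (Rabs (a s) + c) ^ p <= (pnorm p a + dimroot p * c) ^ p.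
Proof.
move=> c0; have N0 := pnorm_ge0 a; have D0 := dimroot_ge0.
case: (Rle_lt_or_eq_dec 0 _ N0) => [N_gt0|N_eq0]; last first.
  rewrite -N_eq0 Rplus_0_l Rpow_mult_distr dimrootK -rsum_const.
  apply: rsum_le => s; have := Rabs_le_pnorm a s; rewrite -N_eq0 => a0.
  have -> : Rabs (a s) = 0 by have := Rabs_pos (a s); lra.
  by rewrite Rplus_0_l; apply: Rle_refl.
case: (Rle_lt_or_eq_dec 0 _ c0) => [c_gt0|<-]; last first.
  rewrite Rmult_0_r Rplus_0_r pnormK; apply: rsum_le => s.
  by rewrite Rplus_0_r; apply: Rle_refl.
case: (Rle_lt_or_eq_dec 0 _ D0) => [D_gt0|D_eq0]; last first.
  have E : \big[Rplus/0]_(s : S) (Rabs (a s) + c) ^ p <=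
      \big[Rplus/0]_(s : S) (pnorm p a + c) ^ p.
    apply: rsum_le => s; apply: pow_incr.
    by have := Rabs_le_pnorm a s; have := Rabs_pos (a s); lra.
  rewrite rsum_const -dimrootK -D_eq0 pow_i in E; last exact/ltP.
  by rewrite Rmult_0_l in E; apply: Rle_trans E _; apply: pow_le; nra.
set N := pnorm p a in N0 N_gt0 *; set D := dimroot p in D0 D_gt0 *.
set T := N + D * c; have T0 : 0 < T by rewrite /T; nra.
set l := N / T.
have l01 : 0 <= l <= 1.
  split; first by apply: Rle_mult_inv_pos.
  by apply: (Rmult_le_reg_r T) => //; rewrite /l /Rdiv Rmult_assoc Rinv_l /T; nra.
have El : l * T = N by rewrite /l; field; lra.
have H s : (Rabs (a s) + c) ^ p <=
    T ^ p * (l * (Rabs (a s) / N) ^ p + (1 - l) * (/ D) ^ p).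
  have -> : Rabs (a s) + c = T * (l * (Rabs (a s) / N) + (1 - l) * / D).
    have -> : T * (l * (Rabs (a s) / N) + (1 - l) * / D) =
      (l * T) * (Rabs (a s) / N) + (T - l * T) * / D by ring.
    by rewrite El /T; field; lra.
  rewrite Rpow_mult_distr; apply: Rmult_le_compat_l; first by apply: pow_le; lra.
  apply: pow_convex => //; first by apply: Rle_mult_inv_pos => //; apply: Rabs_pos.
  by apply: Rlt_le; apply: Rinv_0_lt_compat.
apply: Rle_trans (rsum_le H) _.
rewrite rsum_mull rsumD rsum_mull rsum_const -dimrootK -/D.
have -> : \big[Rplus/0]_(s : S) (Rabs (a s) / N) ^ p = 1.
  have -> : 1 = N ^ p * (/ N) ^ p by rewrite -Rpow_mult_distr Rinv_r ?pow1 //; lra.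
  rewrite pnormK -rsum_mulr; apply: eq_bigr => s _.
  by rewrite Rpow_mult_distr.
have -> : D ^ p * ((1 - l) * (/ D) ^ p) = (1 - l) * (D * / D) ^ p.
  by rewrite Rpow_mult_distr; ring.
rewrite Rinv_r ?pow1; last lra.
by apply: Req_le; ring.
Qed.

(* Minkowski's inequality against a constant vector, whose p-norm is [dimroot p * c]. *)
Lemma pnorm_le_shift y a c : 0 <= c -> (forall s, Rabs (y s) <= Rabs (a s) + c) ->
  pnorm p y <= pnorm p a + dimroot p * c.
Proof.
move=> c0 le_y.
have N0 := pnorm_ge0 a; have D0 := dimroot_ge0.
apply: (pow_le_inv p_gt0); first by nra.
apply: Rle_trans (rsum_pow_shift a c0); rewrite pnormK.
by apply: rsum_le => s; apply: pow_incr; split; [apply: Rabs_pos | apply: le_y].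
Qed.

Lemma pnorm_le_sup y c : 0 <= c -> (forall s, Rabs (y s) <= c) ->
  pnorm p y <= dimroot p * c.
Proof.
move=> c0 le_y.
have N0 : pnorm p (fun=> 0) = 0.
  by have := pnorm_scale (fun=> 0) (Rle_refl 0); rewrite !Rmult_0_l.
have := @pnorm_le_shift y (fun=> 0) c c0; rewrite N0 Rplus_0_l; apply.
by move=> s; rewrite Rabs_R0 Rplus_0_l.
Qed.

End PNorm.

Lemma exp_INR_mul x k : exp (INR k * x) = exp x ^ k.
Proof.
elim: k => [|k IHk]; first by rewrite Rmult_0_l exp_0.
by rewrite S_INR Rmult_plus_distr_r Rmult_1_l exp_plus IHk /=; ring.
Qed.

(** * Squared p-norm under centred noise *)

Section MartingaleStep.
Variables (S Om : finType) (m : nat).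
Local Notation p := (m.+1.*2).
Local Notation N := (pnorm p).
Local Notation D := (dimroot S p).
Hypothesis S_gt0 : (0 < #|S|)%nat.

Let p_gt0 : (0 < p)%nat. Proof. by rewrite doubleS. Qed.

Let INRp : INR p = 2 * INR m.+1.
Proof. by rewrite -mul2n mult_INR. Qed.

Lemma dimroot_gt0 : 0 < D.
Proof.
have := dimrootK S p_gt0; have := dimroot_ge0 S p => D0 E.
case: (Rle_lt_or_eq_dec 0 _ D0) => // D_eq0.
rewrite -D_eq0 pow_i in E; last exact/ltP.
by have := lt_0_INR #|S| (ltP S_gt0); lra.
Qed.

(* Hoelder's inequality, through Young applied to [z = ((|u s| + H) D / M)^2]. *)
Lemma rsum_pow_shift2 (u : S -> R) H : 0 <= H -> 0 < N u ->
  \big[Rplus/0]_(s : S) (Rabs (u s) + H) ^ m.*2 <= D ^ 2 * (N u + D * H) ^ m.*2.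
Proof.
move=> H0 N0; have D0 := dimroot_gt0.
set M := N u + D * H; have M0 : 0 < M by rewrite /M; nra.
(* The scale [D / M] brings the average of [z s ^ m.+1] over the states to at most 1; Young's
   inequality passes this bound on to the average of [z s ^ m]. *)
set z := fun s => ((Rabs (u s) + H) * (D / M)) ^ 2.
have DM0 : 0 < D / M by apply: Rdiv_lt_0_compat.
have powE k s : ((Rabs (u s) + H) * (D / M)) ^ k.*2 = z s ^ k.
  by rewrite pow_double.
have m1 : 0 < INR m.+1 by apply: lt_0_INR; apply/ltP.
have mS : INR m.+1 = INR m + 1 by rewrite S_INR.
have sumz : \big[Rplus/0]_(s : S) z s ^ m.+1 <= INR #|S|.
  have -> : \big[Rplus/0]_(s : S) z s ^ m.+1 =
      (D / M) ^ p * \big[Rplus/0]_(s : S) (Rabs (u s) + H) ^ p.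
    rewrite -rsum_mull; apply: eq_bigr => s _; rewrite -powE Rpow_mult_distr.
    exact: Rmult_comm.
  rewrite -(dimrootK S p_gt0).
  have -> : D ^ p = (D / M) ^ p * M ^ p.
    by rewrite -Rpow_mult_distr; congr (_ ^ _); field; lra.
  apply: Rmult_le_compat_l; first by apply: pow_le; lra.
  exact: rsum_pow_shift.
have sumz' : \big[Rplus/0]_(s : S) z s ^ m <= INR #|S|.
  apply: (Rmult_le_reg_l (INR m.+1)) => //; rewrite -rsum_mull.
  apply: (@Rle_trans _ (\big[Rplus/0]_(s : S) (INR m * z s ^ m.+1 + 1))).
    by apply: rsum_le => s; apply: young_pow; apply: pow2_ge_0.
  rewrite rsumD rsum_mull rsum_const mS; have := pos_INR m; nra.
have -> : \big[Rplus/0]_(s : S) (Rabs (u s) + H) ^ m.*2 =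
    (M / D) ^ m.*2 * \big[Rplus/0]_(s : S) z s ^ m.
  rewrite -rsum_mull; apply: eq_bigr => s _; rewrite -powE -Rpow_mult_distr.
  by congr (_ ^ _); field; lra.
have E : D ^ 2 * M ^ m.*2 = (M / D) ^ m.*2 * INR #|S|.
  rewrite -(dimrootK S p_gt0) doubleS.
  have -> : D ^ (m.*2).+2 = D ^ m.*2 * D ^ 2 by rewrite /=; ring.
  rewrite -Rmult_assoc -Rpow_mult_distr.
  have -> : M / D * D = M by field; lra.
  exact: Rmult_comm.
rewrite E; apply: Rmult_le_compat_l => //; apply: pow_le.
by apply: Rlt_le; apply: Rdiv_lt_0_compat.
Qed.

Variables (w : Om -> R) (h : Om -> S -> R) (u : S -> R) (H : R).
Hypotheses (w_ge0 : forall o, 0 <= w o) (w_sum1 : \big[Rplus/0]_(o : Om) w o = 1).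
Hypotheses (h_mean : forall s, \big[Rplus/0]_(o : Om) (w o * h o s) = 0).
Hypotheses (h_bound : forall o s, Rabs (h o s) <= H) (H_ge0 : 0 <= H).

(* Bernoulli's inequality linearizes the (2/p)-th power at [||u||^p], after which
   the p-th powers are expanded to second order coordinatewise. *)
Lemma martingale_step_far : 0 < N u -> INR p * D * H <= N u ->
  \big[Rplus/0]_(o : Om) (w o * N (fun s => (u s + h o s)%R) ^ 2) <=
  N u ^ 2 + 3 * INR p * D ^ 2 * H ^ 2.
Proof.
move=> N0 far; have D0 := dimroot_gt0.
set n0 := N u in N0 far *.
have m1 : 0 < INR m.+1 by apply: lt_0_INR; apply/ltP.
set y := fun o => N (fun s => (u s + h o s)%R).
have tangent o : y o ^ 2 <= n0 ^ 2 * (1 + / INR m.+1 * (y o ^ p / n0 ^ p - 1)).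
  have B := bernoulli_ge m.+1 (pow2_ge_0 (y o / n0)).
  have E : ((y o / n0) ^ 2) ^ m.+1 = y o ^ p / n0 ^ p.
    by rewrite -pow_double /Rdiv Rpow_mult_distr pow_inv.
  rewrite E in B.
  have B' : (y o / n0) ^ 2 <= 1 + / INR m.+1 * (y o ^ p / n0 ^ p - 1).
    apply: (Rmult_le_reg_l (INR m.+1)) => //.
    have -> : INR m.+1 * (1 + / INR m.+1 * (y o ^ p / n0 ^ p - 1)) =
      INR m.+1 + (y o ^ p / n0 ^ p - 1) by set q := _ / _; field; lra.
    lra.
  have -> : y o ^ 2 = n0 ^ 2 * (y o / n0) ^ 2 by field; lra.
  apply: Rmult_le_compat_l B'; exact: pow2_ge_0.
have step1 : \big[Rplus/0]_(o : Om) (w o * y o ^ 2) <=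
   n0 ^ 2 * (1 + / INR m.+1 * ((\big[Rplus/0]_(o : Om) (w o * y o ^ p)) / n0 ^ p - 1)).
  apply: (@Rle_trans _ (\big[Rplus/0]_(o : Om)
     (w o * (n0 ^ 2 * (1 - / INR m.+1)) + w o * y o ^ p * (n0 ^ 2 * / INR m.+1 / n0 ^ p)))).
    apply: rsum_le => o.
    have := Rmult_le_compat_l _ _ _ (w_ge0 o) (tangent o) => T.
    apply: Rle_trans T _; apply: Req_le; field.
    by split; [|apply: pow_nonzero]; lra.
  rewrite rsumD !rsum_mulr w_sum1; apply: Req_le; field.
  by split; [apply: pow_nonzero|]; lra.
have taylor : \big[Rplus/0]_(o : Om) (w o * y o ^ p) <=
   n0 ^ p + INR p * INR p.-1 / 2 * H ^ 2 * (D ^ 2 * (n0 + D * H) ^ m.*2).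
  (* Since [p] is even, the absolute values disappear and each coordinate contributes a genuine
     polynomial in [h o s]. *)
  have -> : \big[Rplus/0]_(o : Om) (w o * y o ^ p) =
     \big[Rplus/0]_(s : S) \big[Rplus/0]_(o : Om) (w o * (u s + h o s) ^ p).
    rewrite exchange_big; apply: eq_bigr => o _.
    rewrite rsum_mull /y pnormK //; congr (_ * _); apply: eq_bigr => s _.
    by rewrite !pow_double pow2_abs.
  have -> : n0 ^ p = \big[Rplus/0]_(s : S) u s ^ p.
    rewrite /n0 pnormK //; apply: eq_bigr => s _.
    by rewrite !pow_double pow2_abs.
  apply: (@Rle_trans _ (\big[Rplus/0]_(s : S)
    (u s ^ p + INR p * INR p.-1 / 2 * H ^ 2 * (Rabs (u s) + H) ^ m.*2))).
    apply: rsum_le => s.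
    (* The second summand is the first-order term; [h_mean] removes it. *)
    apply: (@Rle_trans _ (\big[Rplus/0]_(o : Om)
      (w o * (u s ^ p + INR p * INR p.-1 / 2 * H ^ 2 * (Rabs (u s) + H) ^ m.*2)
       + w o * h o s * (INR p * u s ^ p.-1)))); last first.
      by rewrite rsumD !rsum_mulr w_sum1 h_mean; apply: Req_le; ring.
    apply: rsum_le => o.
    rewrite (Rmult_assoc (w o) (h o s)) -Rmult_plus_distr_l.
    apply: Rmult_le_compat_l => //.
    have T := pow_taylor2 (u s) (h o s) m.*2.
    change m.*2.+2 with p in T; change m.*2.+1 with p.-1 in T.
    have {}T := Rle_trans _ _ _ (Rle_abs _) T.
    set q := INR p * INR p.-1 / 2 in T *.
    have q0 : 0 <= q.
      rewrite /q; have := pos_INR p; have := pos_INR p.-1; nra.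
    have hH := h_bound o s; have h0 := Rabs_pos (h o s).
    have H1 : h o s ^ 2 <= H ^ 2 by rewrite -(pow2_abs (h o s)); apply: pow_incr.
    have H2 : (Rabs (u s) + Rabs (h o s)) ^ m.*2 <= (Rabs (u s) + H) ^ m.*2.
      by apply: pow_incr; have := Rabs_pos (u s); lra.
    have H3 : q * h o s ^ 2 * (Rabs (u s) + Rabs (h o s)) ^ m.*2 <=
              q * H ^ 2 * (Rabs (u s) + H) ^ m.*2.
      apply: Rmult_le_compat => //.
      - by have := pow2_ge_0 (h o s); nra.
      - by apply: pow_le; have := Rabs_pos (u s); lra.
      by apply: Rmult_le_compat_l.
    lra.
  rewrite rsumD rsum_mull; apply: Rplus_le_compat_l; apply: Rmult_le_compat_l.
    have := pos_INR p; have := pos_INR p.-1; have := pow2_ge_0 H => a b c.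
    by apply: Rmult_le_pos => //; nra.
  exact: rsum_pow_shift2.
apply: Rle_trans step1 _.
have P0 : 0 < n0 ^ p by apply: pow_lt.
(* This uses [far]: the ratio is at most [1 + 1/p], so even its p-th power is at most e. This is the
   3 in the conclusion. *)
have ratio3 : ((n0 + D * H) / n0) ^ m.*2 <= 3.
  have p0 : 0 < INR p by rewrite INRp; lra.
  set t := (n0 + D * H) / n0.
  have t1 : 1 <= t <= 1 + / INR p.
    have -> : t = 1 + D * H / n0 by rewrite /t; field; lra.
    have Q : 0 <= D * H / n0 by apply: Rle_mult_inv_pos => //; nra.
    split; first lra.
    apply: Rplus_le_compat_l; apply: (Rmult_le_reg_l (INR p * n0)); first nra.
    have -> : INR p * n0 * (D * H / n0) = INR p * D * H by field; lra.
    by have -> : INR p * n0 * / INR p = n0 by field; lra.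
  apply: (@Rle_trans _ (t ^ p)).
    by rewrite doubleS; apply: Rle_pow; [lra | lia].
  apply: (@Rle_trans _ (exp (/ INR p) ^ p)).
    by apply: pow_incr; have := exp_ineq1_le (/ INR p); lra.
  by rewrite -exp_INR_mul Rinv_r; [apply: exp_le_3 | lra].
have E2 : n0 ^ p = n0 ^ 2 * n0 ^ m.*2 by rewrite doubleS /=; ring.
have nm0 : 0 < n0 ^ m.*2 by apply: pow_lt.
apply: (@Rle_trans _ (n0 ^ 2 + INR p.-1 * H ^ 2 * D ^ 2 * ((n0 + D * H) / n0) ^ m.*2)).
  have -> : INR p.-1 * H ^ 2 * D ^ 2 * ((n0 + D * H) / n0) ^ m.*2 =
    n0 ^ 2 * / INR m.+1 *
      ((INR p * INR p.-1 / 2 * H ^ 2 * (D ^ 2 * (n0 + D * H) ^ m.*2)) / n0 ^ p).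
    rewrite INRp E2 /Rdiv Rpow_mult_distr pow_inv; field.
    by repeat split; lra.
  have X : (\big[Rplus/0]_(o : Om) (w o * y o ^ p)) / n0 ^ p - 1 <=
     (INR p * INR p.-1 / 2 * H ^ 2 * (D ^ 2 * (n0 + D * H) ^ m.*2)) / n0 ^ p.
    have := Rmult_le_compat_r _ _ _ (Rlt_le _ _ (Rinv_0_lt_compat _ P0)) taylor.
    rewrite Rmult_plus_distr_r Rinv_r; last lra.
    rewrite /Rdiv; lra.
  have C0 : 0 <= n0 ^ 2 * / INR m.+1.
    by apply: Rmult_le_pos; [apply: pow2_ge_0 | apply/Rlt_le/Rinv_0_lt_compat].
  have := Rmult_le_compat_l _ _ _ C0 X; lra.
have Pp : 0 <= INR p.-1 * H ^ 2 * D ^ 2.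
  by apply: Rmult_le_pos (pow2_ge_0 _); apply: Rmult_le_pos (pow2_ge_0 _); apply: pos_INR.
have Pp' : INR p.-1 <= INR p by apply: le_INR; lia.
have HD : 0 <= H ^ 2 * D ^ 2 by have := pow2_ge_0 H; have := pow2_ge_0 D; nra.
have := Rmult_le_compat_l _ _ _ Pp ratio3; nra.
Qed.

Lemma martingale_step :
  \big[Rplus/0]_(o : Om) (w o * N (fun s => (u s + h o s)%R) ^ 2) <=
  N u ^ 2 + 3 * INR p * D ^ 2 * H ^ 2.
Proof.
have N0 := pnorm_ge0 p u; have D0 := dimroot_gt0.
have DH0 : 0 <= D * H by nra.
have p1 : 1 <= INR p by apply: (le_INR 1); apply/leP.
case: (Rle_lt_dec (N u) (INR p * D * H)) => near; last first.
  apply: martingale_step_far; last exact: Rlt_le.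
  apply: Rle_lt_trans near; rewrite Rmult_assoc; nra.
have B o : w o * N (fun s => (u s + h o s)%R) ^ 2 <= w o * (N u + D * H) ^ 2.
  apply: Rmult_le_compat_l => //; apply: pow_incr; split; first exact: pnorm_ge0.
  apply: pnorm_le_shift => // s; have := Rabs_triang (u s) (h o s).
  by have := h_bound o s; lra.
apply: Rle_trans (rsum_le B) _; rewrite rsum_mulr w_sum1.
have := Rmult_le_compat_r _ _ _ DH0 near.
have : 0 <= (INR p - 1) * (D * H) ^ 2 by apply: Rmult_le_pos; [lra | apply: pow2_ge_0].
nra.
Qed.

End MartingaleStep.

(** * Value functions and trajectories *)

Section SupNorm.
Variable S : finType.

Lemma Rabs_le_sup_norm (f : S -> R) s : Rabs (f s) <= sup_norm f.
Proof.
rewrite /sup_norm; have := mem_index_enum s; elim: (index_enum S) => //= t r IHr.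
rewrite inE big_cons => /orP[/eqP->|/IHr]; first exact: Rmax_l.
by move=> H; apply: Rle_trans H (Rmax_r _ _).
Qed.

Lemma sup_norm_ge0 (f : S -> R) : 0 <= sup_norm f.
Proof.
apply: (big_ind (fun x => 0 <= x)) => [|x y x0 y0|s _]; first exact: Rle_refl.
  exact: Rle_trans x0 (Rmax_l _ _).
exact: Rabs_pos.
Qed.

Lemma sup_norm_le (f : S -> R) c : 0 <= c -> (forall s, Rabs (f s) <= c) ->
  sup_norm f <= c.
Proof.
move=> c0 H; apply: (big_ind (fun x => x <= c)) => // x y; exact: Rmax_lub.
Qed.

End SupNorm.

(** * Bellman's equation for the discounted value function *)

Section ValueFunction.
Variables (S Act : finType) (P : Act -> S -> S -> R) (Rw : S -> Act -> R).
Variables (beta : R) (pol : S -> Act -> R).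

(** [state_dist] is built by appending the last transition, while Bellman's equation conditions on
    the first one. *)
Lemma state_dist_first_step s0 k s1 : state_dist P pol s0 k.+1 s1 =
  \big[Rplus/0]_(a : Act) \big[Rplus/0]_(s : S)
    (pol s0 a * P a s0 s * state_dist P pol s k s1).
Proof.
elim: k s1 => [|k IHk] s1.
  rewrite /= (bigD1 s0) //= [X in _ + X]big1 ?Rplus_0_r => [|s /negbTE sN]; last first.
    by apply: big1 => a _; rewrite sN; ring.
  apply: eq_bigr => a _; rewrite eqxx (bigD1 s1) //= eqxx [X in _ + X]big1; first by ring.
  by move=> s sN; rewrite eq_sym (negbTE sN); ring.
change (state_dist P pol s0 k.+2 s1) with
  (\big[Rplus/0]_(s : S) \big[Rplus/0]_(a : Act)
     (state_dist P pol s0 k.+1 s * pol s a * P a s s1)).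
have -> : \big[Rplus/0]_(a : Act) \big[Rplus/0]_(s : S)
    (pol s0 a * P a s0 s * state_dist P pol s k.+1 s1) =
  \big[Rplus/0]_(a : Act) \big[Rplus/0]_(s : S) \big[Rplus/0]_(s2 : S)
   \big[Rplus/0]_(a2 : Act)
    (pol s0 a * P a s0 s * (state_dist P pol s k s2 * pol s2 a2 * P a2 s2 s1)).
  apply: eq_bigr => a _; apply: eq_bigr => s _ /=.
  by rewrite -rsum_mull; apply: eq_bigr => s2 _; rewrite rsum_mull.
rewrite (eq_bigr (fun s2 => \big[Rplus/0]_(a2 : Act) \big[Rplus/0]_(a : Act)
   \big[Rplus/0]_(s : S)
    (pol s0 a * P a s0 s * (state_dist P pol s k s2 * pol s2 a2 * P a2 s2 s1)))).
  rewrite exchange_big [RHS](eq_bigr (fun a => \big[Rplus/0]_(a2 : Act)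
   \big[Rplus/0]_(s2 : S) \big[Rplus/0]_(s : S)
    (pol s0 a * P a s0 s * (state_dist P pol s k s2 * pol s2 a2 * P a2 s2 s1)))).
    rewrite [RHS]exchange_big; apply: eq_bigr => a2 _; exact: exchange_big.
  move=> a _; rewrite exchange_big [RHS]exchange_big; apply: eq_bigr => s2 _.
  exact: exchange_big.
move=> s2 _; apply: eq_bigr => a2 _; rewrite IHk Rmult_assoc -rsum_mulr.
apply: eq_bigr => a _; rewrite -rsum_mulr; apply: eq_bigr => s _; ring.
Qed.

Lemma exp_reward0 s : exp_reward P Rw pol s 0 = \big[Rplus/0]_(a : Act) (pol s a * Rw s a).
Proof.
rewrite /exp_reward (bigD1 s) //= [X in _ + X]big1 ?Rplus_0_r => [|t /negbTE tN].
  by apply: eq_bigr => a _; rewrite eqxx; ring.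
by apply: big1 => a _; rewrite tN; ring.
Qed.

Lemma exp_rewardS s k : exp_reward P Rw pol s k.+1 =
  \big[Rplus/0]_(a : Act) \big[Rplus/0]_(t : S)
    (pol s a * P a s t * exp_reward P Rw pol t k).
Proof.
rewrite /exp_reward.
rewrite (eq_bigr (fun s2 => \big[Rplus/0]_(a : Act) \big[Rplus/0]_(t : S)
   \big[Rplus/0]_(a2 : Act)
    (pol s a * P a s t * (state_dist P pol t k s2 * pol s2 a2 * Rw s2 a2)))).
  rewrite exchange_big; apply: eq_bigr => a _; rewrite exchange_big.
  apply: eq_bigr => t _; rewrite -rsum_mull; apply: eq_bigr => s2 _.
  by rewrite rsum_mull.
move=> s2 _.
rewrite (eq_bigr (fun a2 => \big[Rplus/0]_(a : Act) \big[Rplus/0]_(t : S)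
    (pol s a * P a s t * (state_dist P pol t k s2 * pol s2 a2 * Rw s2 a2)))).
  by rewrite exchange_big; apply: eq_bigr => a _; exact: exchange_big.
move=> a2 _; rewrite state_dist_first_step Rmult_assoc -rsum_mulr.
apply: eq_bigr => a _; rewrite -rsum_mulr; apply: eq_bigr => t _; ring.
Qed.

Lemma Un_cv_rsum (I : finType) (u : I -> nat -> R) (l : I -> R) :
  (forall i, Un_cv (u i) (l i)) ->
  Un_cv (fun k => \big[Rplus/0]_(i : I) u i k) (\big[Rplus/0]_(i : I) l i).
Proof.
move=> ul; elim: (index_enum I) => [|i r IHr].
  move=> e e0; exists O => k _; rewrite !big_nil /Rdist Rminus_diag Rabs_R0; lra.
have := CV_plus _ _ _ _ (ul i) IHr; rewrite big_cons.
by apply: Un_cv_ext => k; rewrite big_cons.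
Qed.

(** The partial sums satisfy the recursion exactly, with one term more on the left; both sides
    converge, and limits are unique. *)
Lemma value_function_bellman V : is_value_function P Rw beta pol V ->
  forall s, V s = \big[Rplus/0]_(a : Act) (pol s a *
    (Rw s a + beta * \big[Rplus/0]_(t : S) (P a s t * V t))).
Proof.
move=> HV s.
pose part t N := sum_f_R0 (fun k => beta ^ k * exp_reward P Rw pol t k) N.
have partS N : part s N.+1 = \big[Rplus/0]_(a : Act) (pol s a * Rw s a) +
   \big[Rplus/0]_(a : Act) \big[Rplus/0]_(t : S) (beta * (pol s a * P a s t) * part t N).
  rewrite /part decomp_sum /=; last by lia.
  rewrite exp_reward0 Rmult_1_l; congr (_ + _).
  elim: N => [|N IHN].
    rewrite /= exp_rewardS -rsum_mull; apply: eq_bigr => a _.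
    by rewrite -rsum_mull; apply: eq_bigr => t _; rewrite /=; ring.
  rewrite [LHS]/= IHN exp_rewardS -rsum_mull -rsumD; apply: eq_bigr => a _.
  by rewrite -rsum_mull -rsumD; apply: eq_bigr => t _; rewrite /=; ring.
have cvS : Un_cv (fun N => part s N.+1) (\big[Rplus/0]_(a : Act) (pol s a * Rw s a) +
   \big[Rplus/0]_(a : Act) \big[Rplus/0]_(t : S) (beta * (pol s a * P a s t) * V t)).
  apply: (Un_cv_ext (fun N => \big[Rplus/0]_(a : Act) (pol s a * Rw s a) +
   \big[Rplus/0]_(a : Act) \big[Rplus/0]_(t : S)
     (beta * (pol s a * P a s t) * part t N))) => [N|]; first by rewrite partS.
  have cst x : Un_cv (fun=> x) x.
    by move=> e e0; exists O => k _; rewrite /Rdist Rminus_diag Rabs_R0; lra.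
  apply: CV_plus => //.
  apply: Un_cv_rsum => a; apply: Un_cv_rsum => t; apply: CV_mult => //; exact: HV.
have cvS' : Un_cv (fun N => part s N.+1) (V s).
  move=> e e0; have [N0 HN0] := HV s e e0; exists N0 => N HN; apply: HN0.
  by move: HN; rewrite /ge; lia.
rewrite (UL_sequence _ _ _ cvS' cvS) -rsumD; apply: eq_bigr => a _.
rewrite Rmult_plus_distr_l; congr (_ + _).
rewrite -Rmult_assoc -rsum_mull; apply: eq_bigr => t _; ring.
Qed.

End ValueFunction.

(** * Splitting off the first transition of a trajectory *)

Section Trajectories.
Variables (S Act : finType).

(** A trajectory does not store its start, so [s] is the state reached after [a], and the tail [tr]
    is a trajectory started at [s]. *)
Definition traj_cons n (a : Act) (s : S) (tr : traj S Act n) : traj S Act n.+1 :=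
  (cons_tuple a tr.1, cons_tuple s tr.2).

Lemma traj_consP n (tr : traj S Act n.+1) : exists a s tr', tr = traj_cons a s tr'.
Proof.
case: tr => u v; exists (thead u), (thead v), ([tuple of behead u], [tuple of behead v]).
congr (_, _); apply: val_inj.
  by rewrite [in LHS](tuple_eta u).
by rewrite [in LHS](tuple_eta v).
Qed.

Lemma rsum_traj0 (F : traj S Act 0 -> R) :
  \big[Rplus/0]_(tr : traj S Act 0) F tr = F ([tuple], [tuple]).
Proof.
rewrite (bigD1 ([tuple], [tuple])) //= big1 ?Rplus_0_r // => -[u v].
by rewrite (tuple0 u) (tuple0 v) => /eqP.
Qed.

Lemma rsum_trajS n (F : traj S Act n.+1 -> R) :
  \big[Rplus/0]_(tr : traj S Act n.+1) F tr =
  \big[Rplus/0]_(a : Act) \big[Rplus/0]_(s : S) \big[Rplus/0]_(tr : traj S Act n)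
    F (traj_cons a s tr).
Proof.
rewrite [RHS](eq_bigr (fun a => \big[Rplus/0]_(q : S * traj S Act n)
    F (traj_cons a q.1 q.2))); last by move=> a _; rewrite pair_bigA.
rewrite pair_bigA /=.
rewrite (reindex (fun q : Act * (S * traj S Act n) => traj_cons q.1 q.2.1 q.2.2)) //=.
exists (fun tr : traj S Act n.+1 => (thead tr.1, (thead tr.2,
     ([tuple of behead tr.1], [tuple of behead tr.2])))).
  move=> [a [s [u v]]] _; rewrite /traj_cons /= !theadE; congr (_, (_, (_, _)));
    exact: val_inj.
by move=> [u v] _; rewrite /traj_cons /=; congr (_, _); apply: val_inj;
  [rewrite [in RHS](tuple_eta u) | rewrite [in RHS](tuple_eta v)].
Qed.

(** The default of [nth] is the start state, [s0] on one side and [s] on the other; the bound on [t]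
    keeps the lookup within the tuple. *)
Lemma st_traj_cons n a s0 s (tr : traj S Act n) t : (t <= n)%nat ->
  st s0 (traj_cons a s tr) t.+1 = st s tr t.
Proof.
case: t => [|t] //= tn.
by apply: set_nth_default; rewrite size_tuple.
Qed.

Lemma act_traj_cons0 n a s (tr : traj S Act n) : act (traj_cons a s tr) ord0 = a.
Proof. by rewrite /act tnth0. Qed.

Lemma act_traj_consS n a s (tr : traj S Act n) i :
  act (traj_cons a s tr) (lift ord0 i) = act tr i.
Proof. by rewrite /act /= tnthS. Qed.

End Trajectories.

Section VTraceStep.
Variables (S Act : finType) (P : Act -> S -> S -> R) (Rw : S -> Act -> R).
Variables (beta : R) (pi pi' : S -> Act -> R) (rhobar cbar : R).
Local Notation rho s a := (Rmin rhobar (ratio pi pi' s a)).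
Local Notation c s a := (Rmin cbar (ratio pi pi' s a)).

Lemma traj_prob_cons n s0 a s (tr : traj S Act n) :
  traj_prob P pi' s0 (traj_cons a s tr) =
  pi' s0 a * P a s0 s * traj_prob P pi' s tr.
Proof.
rewrite /traj_prob big_ord_recl act_traj_cons0 st_traj_cons //; congr (_ * _).
apply: eq_bigr => i _; rewrite act_traj_consS lift0 !st_traj_cons //.
exact: ltnW.
Qed.

(** Every summand after the first contains [beta] and the first truncated ratio [c]; what is left
    after factoring them out is the target along the tail. The inductions on the horizon rest on
    this. *)
Lemma vtrace_target_cons n V s0 a s (tr : traj S Act n) :
  vtrace_target P Rw pi pi' beta cbar rhobar V s0 (traj_cons a s tr) =
  rho s0 a * (Rw s0 a + beta * V s - V s0) +
  beta * c s0 a * vtrace_target P Rw pi pi' beta cbar rhobar V s tr.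
Proof.
rewrite /vtrace_target big_ord_recl big_pred0 // act_traj_cons0 st_traj_cons //.
congr (_ + _); first by rewrite /=; ring.
rewrite -rsum_mull; apply: eq_bigr => t _.
rewrite act_traj_consS !lift0 !st_traj_cons //; last exact: ltnW.
rewrite (big_mkcond (fun j : 'I_n.+1 => (j < t.+1)%nat)) big_ord_recl act_traj_cons0 /=.
have -> : \big[Rmult/1]_(i < n) (if (bump 0 i < t.+1)%nat then
    c (nth s0 (s :: tr.2) i) (act (traj_cons a s tr) (lift ord0 i)) else 1) =
    \big[Rmult/1]_(j < n | (j < t)%nat) c (st s tr j) (act tr j).
  rewrite [RHS]big_mkcond; apply: eq_bigr => i _; rewrite act_traj_consS /bump /=.
  by rewrite add1n ltnS -(@st_traj_cons S Act n a s0) // ltnW.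
have reorder x y z u v w : x * y * (z * u) * v * w = x * z * (y * u * v * w) by ring.
exact: reorder.
Qed.

End VTraceStep.

(** * The expected V-trace update *)

(** [1 - gamma_factor] is [(1 - beta) * krho] times the geometric sum of the powers of [beta * kc]
    below [n]. Its Horner step matches the removal of one transition. *)
Lemma gamma_factorS beta kc krho n : beta * kc < 1 ->
  gamma_factor beta kc krho n.+1 =
  1 - (1 - beta) * krho - beta * kc * (1 - gamma_factor beta kc krho n).
Proof. by move=> q1; rewrite /gamma_factor /=; field; lra. Qed.

(** The Horner form has no exceptional value at [q = 1], so a single bound on the targets serves all
    three cases of [noise_const]. *)
Fixpoint geom_sum (q : R) (n : nat) : R :=
  if n is k.+1 then 1 + q * geom_sum q k else 0.

Lemma geom_sum_ge0 q n : 0 <= q -> 0 <= geom_sum q n.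
Proof. by move=> q0; elim: n => [|n IHn] /=; [lra | nra]. Qed.

Lemma geom_sumE q n : geom_sum q n * (1 - q) = 1 - q ^ n.
Proof.
elim: n => [|n IHn] /=; first by ring.
have -> : (1 + q * geom_sum q n) * (1 - q) = 1 - q + q * (geom_sum q n * (1 - q)) by ring.
by rewrite IHn; ring.
Qed.

(** The closed form [(1 - q^n) / (1 - q)] loses [q^n] in the numerator if [q < 1], and, written
    [(q^n - 1) / (q - 1)], loses the 1 if [q > 1]; at [q = 1] the sum is [n]. *)
Lemma noise_const_ge beta cbar rhobar n : 0 <= beta * cbar ->
  32 * (rhobar * geom_sum (beta * cbar) n) ^ 2 <= noise_const beta cbar rhobar n.
Proof.
move=> q0; rewrite /noise_const; set q := beta * cbar in q0 *.
have g0 := geom_sum_ge0 n q0; have gE := geom_sumE q n.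
have qn0 := pow_le q n q0.
have r0 := pow2_ge_0 rhobar.
rewrite Rpow_mult_distr -Rmult_assoc.
case: (Rlt_dec q 1) => q1; last case: (Req_EM_T q 1) => q1'; rewrite /is_left.
- have -> : 32 * rhobar ^ 2 / (1 - q) ^ 2 =
      32 * rhobar ^ 2 * (/ (1 - q)) ^ 2 by field; lra.
  apply: Rmult_le_compat_l; first lra.
  apply: pow_incr; split=> //.
  apply: (Rmult_le_reg_r (1 - q)); first lra.
  rewrite Rinv_l; lra.
- apply: Rmult_le_compat_l; first lra.
  apply: Req_le; suff -> : geom_sum q n = INR n by [].
  rewrite q1'; elim: n {g0 gE qn0} => [|n IHn] //.
  by rewrite S_INR [LHS]/= IHn; ring.
- have -> : 32 * rhobar ^ 2 * q ^ (2 * n) / (q - 1) ^ 2 =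
      32 * rhobar ^ 2 * (q ^ n / (q - 1)) ^ 2.
    by rewrite mul2n -addnn -plusE pow_add; field; lra.
  apply: Rmult_le_compat_l; first lra.
  apply: pow_incr; split=> //.
  apply: (Rmult_le_reg_r (q - 1)); first lra.
  have -> : q ^ n / (q - 1) * (q - 1) = q ^ n by field; lra.
  lra.
Qed.

(** * Marginals of a product distribution *)

Section ProductExpectation.
Variables (I T : finType) (p : I -> T -> R).
Hypothesis p_sum1 : forall i, \big[Rplus/0]_(t : T) p i t = 1.

(** With [f] absorbed into the factor of index [i0], the sum over functions becomes a product of
    sums, and all other factors are 1. *)
Lemma rsum_prod_marginal i0 (f : T -> R) :
  \big[Rplus/0]_(om : {ffun I -> T}) ((\big[Rmult/1]_(i : I) p i (om i)) * f (om i0)) =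
  \big[Rplus/0]_(t : T) (p i0 t * f t).
Proof.
pose F i t := p i t * (if i == i0 then f t else 1).
transitivity (\big[Rmult/1]_(i : I) \big[Rplus/0]_(t : T) F i t).
  rewrite bigA_distr_bigA; apply: eq_bigr => om _.
  rewrite /F big_split; congr (_ * _).
  rewrite (bigD1 i0) //= eqxx big1 => [|i /negbTE -> //].
  by rewrite Rmult_1_r.
rewrite (bigD1 i0) //= [X in _ * X]big1 ?Rmult_1_r => [|i /negbTE iN]; last first.
  by rewrite -[RHS](p_sum1 i); apply: eq_bigr => t _; rewrite /F iN Rmult_1_r.
by apply: eq_bigr => t _; rewrite /F eqxx.
Qed.

Lemma rsum_prod1 (i0 : I) :
  \big[Rplus/0]_(om : {ffun I -> T}) (\big[Rmult/1]_(i : I) p i (om i)) = 1.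
Proof.
have := rsum_prod_marginal i0 (fun=> 1); rewrite !rsum_mulr !Rmult_1_r => ->.
exact: p_sum1.
Qed.

End ProductExpectation.

Section TruncatedRatios.
Variables (S Act : finType) (pi pi' : S -> Act -> R).
Hypotheses (pi_pol : is_policy pi) (pi'_pol : is_policy pi').
Hypothesis pi_supp : forall s a, 0 < pi s a -> 0 < pi' s a.

Lemma ratio_ge0 s a : 0 <= ratio pi pi' s a.
Proof.
rewrite /ratio; have p0 := pi_pol.1 s a.
case: (Rle_lt_or_eq_dec _ _ p0) => [/pi_supp p'_gt0|<-].
  exact: Rle_mult_inv_pos.
by rewrite /Rdiv Rmult_0_l; apply: Rle_refl.
Qed.

Lemma behavior_ratio s a : pi' s a * ratio pi pi' s a = pi s a.
Proof.
rewrite /ratio; have p0 := pi_pol.1 s a.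
case: (Rle_lt_or_eq_dec _ _ p0) => [/pi_supp p'_gt0|<-]; last by rewrite /Rdiv; ring.
by field; lra.
Qed.

Lemma behavior_trunc_ratio tr s a :
  pi' s a * Rmin tr (ratio pi pi' s a) = Rmin (tr * pi' s a) (pi s a).
Proof.
have p'0 := pi'_pol.1 s a; have E := behavior_ratio s a.
rewrite /Rmin; case: Rle_dec => H1; case: Rle_dec => H2 /=; nra.
Qed.

Lemma exp_trunc_ratio_le1 tr s : exp_trunc_ratio pi pi' tr s <= 1.
Proof.
rewrite -(pi_pol.2 s); apply: rsum_le => a; rewrite -[X in _ <= X]behavior_ratio.
by apply: Rmult_le_compat_l (Rmin_r _ _); apply: pi'_pol.1.
Qed.

(** Were it zero, each term and hence each [pi s a] would vanish. This makes [kc], [krho] and the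
    denominator of [pi_trunc] positive. *)
Lemma exp_trunc_ratio_gt0 tr s : 0 < tr -> 0 < exp_trunc_ratio pi pi' tr s.
Proof.
move=> tr0; apply: Rnot_le_lt => le0.
have t0 a : 0 <= pi' s a * Rmin tr (ratio pi pi' s a).
  apply: Rmult_le_pos; first exact: pi'_pol.1.
  by apply: Rmin_glb (ratio_ge0 s a); lra.
have pi0 a : pi s a = 0.
  have := rsum_ge_term a t0; rewrite -/(exp_trunc_ratio pi pi' tr s) => H.
  have := behavior_ratio s a; have := pi_pol.1 s a; have := pi'_pol.1 s a => p'0 p0 E.
  case: (Rle_lt_or_eq_dec _ _ p0) => // p_gt0.
  have p'_gt0 := pi_supp p_gt0.
  have r0 : 0 < ratio pi pi' s a by nra.
  have : 0 < Rmin tr (ratio pi pi' s a) by apply: Rmin_glb_lt.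
  by nra.
by have := pi_pol.2 s; rewrite big1 // => E; lra.
Qed.

End TruncatedRatios.

(** * Contraction of the mean update and the resulting one-step bound *)

Section Contraction.
Variables (S Act : finType) (P : Act -> S -> S -> R) (Rw : S -> Act -> R).
Variables (beta : R) (pi pi' : S -> Act -> R) (rhobar cbar : R).
Hypothesis P_tr : is_transition P.
Hypothesis Rw01 : forall s a, 0 <= Rw s a <= 1.
Hypothesis beta01 : 0 < beta < 1.
Hypotheses (pi_pol : is_policy pi) (pi'_pol : is_policy pi').
Hypothesis pi_supp : forall s a, 0 < pi s a -> 0 < pi' s a.
Hypothesis cbar_rhobar : 0 < cbar <= rhobar.

Local Notation rho s a := (Rmin rhobar (ratio pi pi' s a)).
Local Notation c s a := (Rmin cbar (ratio pi pi' s a)).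
Local Notation target := (vtrace_target P Rw pi pi' beta cbar rhobar).
Local Notation prob := (traj_prob P pi').

Let trunc_ratio_ge0 s a : 0 <= c s a.
Proof.
by apply: Rmin_glb; [lra | apply: (ratio_ge0 pi_pol pi_supp)].
Qed.

Let trunc_ratio_le s a : c s a <= rho s a.
Proof. by apply: Rle_min_compat_r; lra. Qed.

Let exp_le1 := exp_trunc_ratio_le1 pi_pol pi'_pol pi_supp.
Let exp_gt0 := exp_trunc_ratio_gt0 pi_pol pi'_pol pi_supp.

Lemma traj_prob_ge0 n s (tr : traj S Act n) : 0 <= prob s tr.
Proof.
apply: big_ind => [|x y|t _]; [exact: Rle_0_1 | exact: Rmult_le_pos |].
by apply: Rmult_le_pos; [apply: pi'_pol.1 | apply: P_tr.1].
Qed.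

Lemma rsum_step x s : \big[Rplus/0]_(a : Act) \big[Rplus/0]_(t : S)
  (pi' s a * P a s t * x) = x.
Proof.
rewrite -[RHS]Rmult_1_l -(pi'_pol.2 s) -rsum_mulr; apply: eq_bigr => a _.
by rewrite rsum_mulr rsum_mull P_tr.2 Rmult_1_r.
Qed.

Lemma traj_prob_sum1 n s : \big[Rplus/0]_(tr : traj S Act n) prob s tr = 1.
Proof.
elim: n s => [|n IHn] s; first by rewrite rsum_traj0 /traj_prob big_ord0.
rewrite rsum_trajS -(rsum_step 1 s); apply: eq_bigr => a _; apply: eq_bigr => t _.
by rewrite -(IHn t) -rsum_mull; apply: eq_bigr => tr _; rewrite traj_prob_cons.
Qed.

Definition mean_target n V s := \big[Rplus/0]_(tr : traj S Act n) (prob s tr * target V s tr).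

Lemma mean_targetS n V s : mean_target n.+1 V s =
  \big[Rplus/0]_(a : Act) \big[Rplus/0]_(t : S) (pi' s a * P a s t *
   (rho s a * (Rw s a + beta * V t - V s) + beta * c s a * mean_target n V t)).
Proof.
rewrite /mean_target rsum_trajS; apply: eq_bigr => a _; apply: eq_bigr => t _.
set x := rho s a * _.
transitivity (\big[Rplus/0]_(tr : traj S Act n)
   (prob t tr * (pi' s a * P a s t * x) +
    pi' s a * P a s t * (beta * c s a) * (prob t tr * target V t tr))).
  by apply: eq_bigr => tr _; rewrite traj_prob_cons vtrace_target_cons -/x; ring.
rewrite rsumD rsum_mulr rsum_mull traj_prob_sum1; ring.
Qed.

Lemma target_bound n V v s (tr : traj S Act n) : (forall t, Rabs (V t) <= v) ->
  Rabs (target V s tr) <= rhobar * geom_sum (beta * cbar) n * (1 + 2 * v).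
Proof.
move=> Vv; have v0 : 0 <= v by have := Vv s; have := Rabs_pos (V s); lra.
elim: n s tr => [|n IHn] s tr.
  by rewrite /vtrace_target big_ord0 Rabs_R0 /=; nra.
have [a [t [{}tr ->]]] := traj_consP tr.
rewrite vtrace_target_cons; apply: Rle_trans (Rabs_triang _ _) _.
rewrite !Rabs_mult (Rabs_pos_eq beta); last lra.
have c0 := trunc_ratio_ge0 s a; have cr := trunc_ratio_le s a.
have cl := Rmin_l cbar (ratio pi pi' s a); have rl := Rmin_l rhobar (ratio pi pi' s a).
rewrite (Rabs_pos_eq (c s a)) // (Rabs_pos_eq (rho s a)); last lra.
have d1 : Rabs (Rw s a + beta * V t - V s) <= 1 + 2 * v.
  by have := Rw01 s a; move: (Vv t) (Vv s); split_Rabs; nra.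
have X := IHn t tr.
have H1 : rho s a * Rabs (Rw s a + beta * V t - V s) <= rhobar * (1 + 2 * v).
  by apply: Rmult_le_compat => //; [lra | apply: Rabs_pos].
have H2 : beta * c s a * Rabs (target V t tr) <=
   beta * cbar * (rhobar * geom_sum (beta * cbar) n * (1 + 2 * v)).
  by apply: Rmult_le_compat => //; [nra | apply: Rabs_pos | nra].
by move: H1 H2 => /=; lra.
Qed.

Lemma mean_target_bound n V v s : (forall t, Rabs (V t) <= v) ->
  Rabs (mean_target n V s) <= rhobar * geom_sum (beta * cbar) n * (1 + 2 * v).
Proof.
move=> Vv; apply: Rle_trans (rsum_abs _) _.
set b := (X in _ <= X); rewrite -[b]Rmult_1_l -(traj_prob_sum1 n s) -rsum_mulr.
apply: rsum_le => tr; rewrite Rabs_mult (Rabs_pos_eq (prob _ _)); last exact: traj_prob_ge0.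
by apply: Rmult_le_compat_l; [apply: traj_prob_ge0 | apply: target_bound].
Qed.

Variables (kc krho : R).
Hypothesis kc_min : is_min_over_states (exp_trunc_ratio pi pi' cbar) kc.
Hypothesis krho_min : is_min_over_states (exp_trunc_ratio pi pi' rhobar) krho.
Local Notation gam := (gamma_factor beta kc krho).

Lemma kc01 : 0 < kc <= 1.
Proof.
have [_ [s ->]] := kc_min; split; last exact: exp_le1.
by apply: exp_gt0; lra.
Qed.

Lemma krho01 : 0 < krho <= 1.
Proof.
have [_ [s ->]] := krho_min; split; last exact: exp_le1.
by apply: exp_gt0; lra.
Qed.

Lemma gamma_factor01 n : 0 <= gam n <= 1.
Proof.
have k0 := kc01; have r0 := krho01.
elim: n => [|n IHn].
  have -> : gam 0 = 1 by rewrite /gamma_factor /Rdiv /=; ring.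
  lra.
rewrite gamma_factorS; last by nra.
have : 0 <= beta * kc <= beta by nra.
nra.
Qed.

Lemma gamma_factor_lt1 n : (0 < n)%nat -> gam n < 1.
Proof.
case: n => // n _; have k0 := kc01; have r0 := krho01; have := gamma_factor01 n => g01.
rewrite gamma_factorS; last by nra.
have : 0 <= beta * kc <= beta by nra.
nra.
Qed.

Variable W : S -> R.
Hypothesis W_fix : forall s, \big[Rplus/0]_(a : Act) \big[Rplus/0]_(t : S)
  (pi' s a * P a s t * (rho s a * (Rw s a + beta * W t - W s))) = 0.

(* Writing [T n] for the expected n-step update of [V - W], one has
   [T n.+1 s = (1 - E rho) (V - W)(s) + beta E ((rho - c) (V - W)(S_1) + c T n (S_1))],
   a combination with nonnegative coefficients. *)
Lemma mean_target_contraction n V X s : (forall t, Rabs (V t - W t) <= X) ->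
  Rabs (V s - W s + mean_target n V s) <= gam n * X.
Proof.
move=> VX; have k0 := kc01.
have X0 : 0 <= X by have := VX s; have := Rabs_pos (V s - W s); lra.
elim: n s => [|n IHn] s.
  rewrite /mean_target rsum_traj0 /vtrace_target big_ord0 Rmult_0_r Rplus_0_r.
  have -> : gam 0 = 1 by rewrite /gamma_factor /Rdiv /=; ring.
  by rewrite Rmult_1_l.
set G := fun t => V t - W t + mean_target n V t in IHn *.
set Er := exp_trunc_ratio pi pi' rhobar s; set Ec := exp_trunc_ratio pi pi' cbar s.
have EE tr x : \big[Rplus/0]_(a : Act) \big[Rplus/0]_(t : S)
   (pi' s a * P a s t * (Rmin tr (ratio pi pi' s a) * x)) = exp_trunc_ratio pi pi' tr s * x.
  rewrite /exp_trunc_ratio -rsum_mulr; apply: eq_bigr => a _.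
  rewrite rsum_mulr rsum_mull P_tr.2; ring.
have decomp : V s - W s + mean_target n.+1 V s = (1 - Er) * (V s - W s) +
   \big[Rplus/0]_(a : Act) \big[Rplus/0]_(t : S) (pi' s a * P a s t *
     (beta * ((rho s a - c s a) * (V t - W t) + c s a * G t))).
  rewrite mean_targetS.
  (* The third sum vanishes by [W_fix]; splitting it off cancels the rewards and leaves an
     expression in [V - W]. *)
  suff -> : \big[Rplus/0]_(a : Act) \big[Rplus/0]_(t : S) (pi' s a * P a s t *
     (rho s a * (Rw s a + beta * V t - V s) + beta * c s a * mean_target n V t)) =
     \big[Rplus/0]_(a : Act) \big[Rplus/0]_(t : S)
      (pi' s a * P a s t * (rho s a * - (V s - W s))) +
     \big[Rplus/0]_(a : Act) \big[Rplus/0]_(t : S) (pi' s a * P a s t *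
     (beta * ((rho s a - c s a) * (V t - W t) + c s a * G t))) +
    \big[Rplus/0]_(a : Act) \big[Rplus/0]_(t : S)
       (pi' s a * P a s t * (rho s a * (Rw s a + beta * W t - W s))).
    by rewrite W_fix EE -/Er; ring.
  rewrite -!rsumD; apply: eq_bigr => a _; rewrite -!rsumD; apply: eq_bigr => t _.
  by rewrite /G; ring.
have bound : Rabs (\big[Rplus/0]_(a : Act) \big[Rplus/0]_(t : S) (pi' s a * P a s t *
     (beta * ((rho s a - c s a) * (V t - W t) + c s a * G t)))) <=
     Er * (beta * X) - Ec * (beta * X * (1 - gam n)).
  have -> : Er * (beta * X) - Ec * (beta * X * (1 - gam n)) =
     \big[Rplus/0]_(a : Act) \big[Rplus/0]_(t : S) (pi' s a * P a s t *
     (beta * ((rho s a - c s a) * X + c s a * (gam n * X)))).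
    rewrite -!EE -rsumB; apply: eq_bigr => a _; rewrite -rsumB; apply: eq_bigr => t _.
    by ring.
  apply: Rle_trans (rsum_abs _) _; apply: rsum_le => a.
  apply: Rle_trans (rsum_abs _) _; apply: rsum_le => t.
  have w0 : 0 <= pi' s a * P a s t.
    by apply: Rmult_le_pos; [apply: pi'_pol.1 | apply: P_tr.1].
  rewrite Rabs_mult Rabs_pos_eq //; apply: Rmult_le_compat_l => //.
  rewrite Rabs_mult (Rabs_pos_eq beta); last lra.
  apply: Rmult_le_compat_l; first lra.
  apply: Rle_trans (Rabs_triang _ _) _; rewrite !Rabs_mult.
  have c0 := trunc_ratio_ge0 s a; have cr := trunc_ratio_le s a.
  rewrite (Rabs_pos_eq (c s a)) // (Rabs_pos_eq (rho s a - c s a)); last lra.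
  apply: Rplus_le_compat; apply: Rmult_le_compat_l => //; first lra.
  exact: IHn.
rewrite decomp; apply: Rle_trans (Rabs_triang _ _) _.
have Er1 : Er <= 1 := exp_le1 _ _.
rewrite Rabs_mult (Rabs_pos_eq (1 - Er)); last lra.
have H1 : (1 - Er) * Rabs (V s - W s) <= (1 - Er) * X.
  by apply: Rmult_le_compat_l => //; lra.
have Hr : krho <= Er by apply: krho_min.1.
have Hc : kc <= Ec by apply: kc_min.1.
have g01 := gamma_factor01 n.
rewrite gamma_factorS; last by nra.
(* So far the bound is [X] times [1 - (1 - beta) Er - beta Ec (1 - gam n)]. It decreases in both
   expectations, so their minima over the states are the worst case. *)
have Q1 : 0 <= (Er - krho) * ((1 - beta) * X).
  by apply: Rmult_le_pos; first lra; apply: Rmult_le_pos; lra.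
have Q2 : 0 <= (Ec - kc) * (beta * X * (1 - gam n)).
  by apply: Rmult_le_pos; first lra; apply: Rmult_le_pos; [nra | lra].
lra.
Qed.

Lemma pnorm_ext p (x y : S -> R) : (forall s, x s = y s) -> pnorm p x = pnorm p y.
Proof. by move=> xy; rewrite /pnorm; congr nroot; apply: eq_bigr => s _; rewrite xy. Qed.

(** The new error is its mean [u] plus centred noise [h]. The sup-norm contraction bounds the moving
    part of [u] by one constant in all coordinates, and Minkowski's inequality charges a factor [D]
    for a constant: this is how [gam n * D] arises. The 2 in the noise comes from subtracting the
    mean from the target. *)
Lemma step_exp_pnorm_le n m e V v (s0 : S) :
  let p := m.+1.*2 in
  let D := dimroot S p in
  let x := fun s => V s - W s in
  0 <= e <= 1 -> (forall s, Rabs (V s) <= v) ->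
  step_exp P Rw pi pi' beta cbar rhobar n e V (fun V' => pnorm p (fun s => V' s - W s) ^ 2)
  <= ((1 - e * (1 - gam n * D)) * pnorm p x) ^ 2 +
     3 * INR p * D ^ 2 * (e * (2 * (rhobar * geom_sum (beta * cbar) n * (1 + 2 * v)))) ^ 2.
Proof.
move=> p D x e01 Vv.
have S0 : (0 < #|S|)%nat by apply/card_gt0P; exists s0.
have p0 : (0 < p)%nat by rewrite /p doubleS.
have g01 := gamma_factor01 n; have N0 := pnorm_ge0 p x.
have D0 : 0 < D by apply: dimroot_gt0.
set B := rhobar * _ * _.
have B0 : 0 <= B.
  by apply: Rle_trans (Rabs_pos _) (mean_target_bound n s0 Vv).
pose u s := x s + e * mean_target n V s.
pose w (om : {ffun S -> traj S Act n}) := \big[Rmult/1]_(s : S) prob s (om s).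
pose h (om : {ffun S -> traj S Act n}) s := e * (target V s (om s) - mean_target n V s).
have Nu : pnorm p u <= (1 - e * (1 - gam n * D)) * pnorm p x.
  have H s : Rabs (u s) <= Rabs ((1 - e) * x s) + e * (gam n * pnorm p x).
    have -> : u s = (1 - e) * x s + e * (V s - W s + mean_target n V s).
      by rewrite /u /x; ring.
    apply: Rle_trans (Rabs_triang _ _) _; apply: Rplus_le_compat_l.
    rewrite Rabs_mult (Rabs_pos_eq e); last lra.
    apply: Rmult_le_compat_l; first lra.
    by apply: mean_target_contraction => t; apply: (Rabs_le_pnorm p0 x).
  have c0 : 0 <= e * (gam n * pnorm p x).
    by apply: Rmult_le_pos; [lra | apply: Rmult_le_pos => //; lra].
  apply: Rle_trans (pnorm_le_shift p0 c0 H) _.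
  rewrite pnorm_scale //; last lra.
  by apply: Req_le; rewrite /D; ring.
have He : 0 <= e * (2 * B) by apply: Rmult_le_pos; lra.
have w0 om : 0 <= w om.
  by apply: big_ind => [|a b|s _]; [exact: Rle_0_1 | exact: Rmult_le_pos | exact: traj_prob_ge0].
have w1 : \big[Rplus/0]_om w om = 1 := rsum_prod1 (@traj_prob_sum1 n) s0.
have h_mean s : \big[Rplus/0]_om (w om * h om s) = 0.
  rewrite (rsum_prod_marginal (@traj_prob_sum1 n) s
     (fun tr => e * (target V s tr - mean_target n V s))).
  transitivity (e * (\big[Rplus/0]_(tr : traj S Act n) (prob s tr * target V s tr)
     - \big[Rplus/0]_(tr : traj S Act n) (prob s tr * mean_target n V s))).
    by rewrite -rsumB -rsum_mull; apply: eq_bigr => tr _; ring.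
  rewrite rsum_mulr traj_prob_sum1 -/(mean_target n V s); ring.
have h_bound om s : Rabs (h om s) <= e * (2 * B).
  rewrite /h Rabs_mult (Rabs_pos_eq e); last lra.
  apply: Rmult_le_compat_l; first lra.
  apply: Rle_trans (Rabs_triang _ _) _; rewrite Rabs_Ropp.
  by have := target_bound s (om s) Vv; have := mean_target_bound n s Vv; rewrite -/B; lra.
have := @martingale_step S _ m S0 w h u _ w0 w1 h_mean h_bound He.
rewrite -/p -/D => M.
apply: Rle_trans (Rplus_le_compat_r _ _ _ (pow_incr _ _ 2 (conj (pnorm_ge0 p u) Nu))).
apply: Rle_trans M; apply: Req_le; apply: eq_bigr => om _.
congr (_ * (_ ^ 2)); apply: pnorm_ext => s.
by rewrite /u /h /x; ring.
Qed.

Lemma step_exp_le n e V g1 g2 : (forall V', g1 V' <= g2 V') ->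
  step_exp P Rw pi pi' beta cbar rhobar n e V g1 <=
  step_exp P Rw pi pi' beta cbar rhobar n e V g2.
Proof.
move=> g12; apply: rsum_le => om; apply: Rmult_le_compat_l => //.
by apply: big_ind => [|a b|s _]; [exact: Rle_0_1 | exact: Rmult_le_pos | exact: traj_prob_ge0].
Qed.

Lemma step_exp_affine n e V g a b (s0 : S) :
  step_exp P Rw pi pi' beta cbar rhobar n e V (fun V' => a * g V' + b) =
  a * step_exp P Rw pi pi' beta cbar rhobar n e V g + b.
Proof.
have Eb := Rmult_1_l b; rewrite -(rsum_prod1 (@traj_prob_sum1 n) s0) in Eb.
rewrite /step_exp -[X in _ = _ + X]Eb -rsum_mull -rsum_mulr -rsumD.
by apply: eq_bigr => om _; ring.
Qed.

Lemma vtrace_exp_le n eps V0 k g1 g2 : (forall V', g1 V' <= g2 V') ->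
  vtrace_exp P Rw pi pi' beta cbar rhobar n eps V0 k g1 <=
  vtrace_exp P Rw pi pi' beta cbar rhobar n eps V0 k g2.
Proof.
elim: k g1 g2 => [|k IHk] g1 g2 g12 /=; first exact: g12.
by apply: IHk => V; apply: step_exp_le.
Qed.

(** An inequality, because the pointwise identity [step_exp_affine] is carried through the recursion
    by monotonicity instead of by an equality of functions. *)
Lemma vtrace_exp_affine n eps V0 k g a b (s0 : S) :
  vtrace_exp P Rw pi pi' beta cbar rhobar n eps V0 k (fun V' => a * g V' + b) <=
  a * vtrace_exp P Rw pi pi' beta cbar rhobar n eps V0 k g + b.
Proof.
elim: k g => [|k IHk] g /=; first exact: Rle_refl.
apply: Rle_trans (IHk _); apply: vtrace_exp_le => V.
by apply: Req_le; apply: step_exp_affine.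
Qed.

End Contraction.

(** * The convergence rate *)

(** Multiplied by the normalizing denominator of [pi_trunc], Bellman's equation acquires the weights
    [pi'] times truncated ratio: the mean weighted temporal difference of [W] is zero under the
    behavior policy. *)
Lemma value_function_trunc_fixpoint (S Act : finType) (P : Act -> S -> S -> R)
    (Rw : S -> Act -> R) (beta : R) (pi pi' : S -> Act -> R) (rhobar : R) (W : S -> R) :
  is_transition P -> is_policy pi -> is_policy pi' ->
  (forall s a, 0 < pi s a -> 0 < pi' s a) -> 0 < rhobar ->
  is_value_function P Rw beta (pi_trunc pi pi' rhobar) W ->
  forall s, \big[Rplus/0]_(a : Act) \big[Rplus/0]_(t : S) (pi' s a * P a s t *
    (Rmin rhobar (ratio pi pi' s a) * (Rw s a + beta * W t - W s))) = 0.
Proof.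
move=> P_tr pi_pol pi'_pol supp rho0 /value_function_bellman HW s.
have den0 := exp_trunc_ratio_gt0 pi_pol pi'_pol supp s rho0.
have denE : \big[Rplus/0]_(b : Act) Rmin (rhobar * pi' s b) (pi s b) =
    exp_trunc_ratio pi pi' rhobar s.
  by apply: eq_bigr => a _; rewrite (behavior_trunc_ratio pi_pol pi'_pol supp).
set d := exp_trunc_ratio pi pi' rhobar s in den0 denE.
pose q a := Rw s a + beta * \big[Rplus/0]_(t : S) (P a s t * W t).
have E : d * W s = \big[Rplus/0]_(a : Act) (Rmin (rhobar * pi' s a) (pi s a) * q a).
  rewrite [W s]HW -rsum_mull; apply: eq_bigr => a _.
  by rewrite /pi_trunc denE /q; field; lra.
transitivity (\big[Rplus/0]_(a : Act) (Rmin (rhobar * pi' s a) (pi s a) * q a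
   - Rmin (rhobar * pi' s a) (pi s a) * W s)).
  apply: eq_bigr => a _.
  transitivity (\big[Rplus/0]_(t : S)
    (P a s t * (pi' s a * Rmin rhobar (ratio pi pi' s a) * (Rw s a - W s)) +
     pi' s a * Rmin rhobar (ratio pi pi' s a) * beta * (P a s t * W t))).
    by apply: eq_bigr => t _; ring.
  rewrite rsumD rsum_mulr rsum_mull P_tr.2.
  by rewrite -(behavior_trunc_ratio pi_pol pi'_pol supp) /q; ring.
by rewrite rsumB -E rsum_mulr denE; ring.
Qed.

Lemma exp_le x y : x <= y -> exp x <= exp y.
Proof. by case=> [/exp_increasing/Rlt_le //|->]; apply: Rle_refl. Qed.

Lemma ln_le x y : 0 < x -> x <= y -> ln x <= ln y.
Proof. by move=> x0 [/(ln_increasing _ _ x0)/Rlt_le //|->]; apply: Rle_refl. Qed.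

Lemma exp_le_inv x : x < 1 -> exp x <= / (1 - x).
Proof.
move=> x1; have := exp_ineq1_le (- x); rewrite exp_Ropp => H.
rewrite -[exp x]Rinv_inv; apply: Rinv_le_contravar; lra.
Qed.

(* [e^(1/48) <= 48/47], and [(48/47)^32 <= 2]. *)
Lemma ln2_ge : 2 / 3 <= ln 2.
Proof.
rewrite -[X in X <= _]ln_exp; apply: ln_le; first exact: exp_pos.
have -> : 2 / 3 = INR 32 * (/ 48) by rewrite /=; field.
rewrite exp_INR_mul; apply: (@Rle_trans _ ((48 / 47) ^ 32)); last by rewrite /=; lra.
apply: pow_incr; split; first exact/Rlt_le/exp_pos.
by apply: Rle_trans (exp_le_inv _) _; lra.
Qed.

Lemma nat_floor_ex z : 0 <= z -> exists m, INR m <= z < INR m + 1.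
Proof.
move=> z0; have [lo hi] := base_Int_part z.
have i0 : (0 <= Int_part z)%Z.
  suff : (-1 < Int_part z)%Z by lia.
  by apply: lt_IZR; lra.
by have [m mE] := IZN _ i0; exists m; rewrite INR_IZR_INZ -mE; lra.
Qed.

(** [D = e^(L/p) <= e^(delta/4) <= 1 / (1 - delta/4)]; the rational bound keeps the later estimates
    algebraic in [delta]. *)
Lemma dimroot_le (S : finType) p delta : (0 < #|S|)%nat -> (0 < p)%nat -> 0 < delta <= 1 ->
  4 * ln (INR #|S|) / delta <= INR p -> dimroot S p <= 4 / (4 - delta).
Proof.
move=> S0 p0 d01 lep; have p0' : 0 < INR p by apply: lt_0_INR; apply/ltP.
set L := ln _ in lep.
have lep' : 4 * L <= INR p * delta.
  have -> : 4 * L = 4 * L / delta * delta by field; lra.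
  by apply: Rmult_le_compat_r; lra.
have E : dimroot S p <= exp (L / INR p).
  apply: (pow_le_inv p0); first exact/Rlt_le/exp_pos.
  rewrite dimrootK // -exp_INR_mul.
  have -> : INR p * (L / INR p) = L by field; lra.
  by rewrite exp_ln; [apply: Rle_refl | apply: lt_0_INR; apply/ltP].
apply: Rle_trans E _; apply: (@Rle_trans _ (exp (delta / 4))).
  apply: exp_le.
  apply: (Rmult_le_reg_r (INR p)) => //.
  have -> : L / INR p * INR p = L by field; lra.
  lra.
apply: Rle_trans (exp_le_inv _) _; first lra.
by apply: Req_le; field; lra.
Qed.

(** * Drift against noise in one step *)

Section StepArithmetic.
Variables (delta A L t : R).
Hypotheses (delta01 : 0 < delta <= 1) (A_ge0 : 0 <= A) (L_ge : 2 / 3 <= L).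
Let c0 := (A + 2) * L / delta ^ 3.
Let K := 64 * (A + 2) * L / delta ^ 3.
Let M := t + K.
Let e := 4 / delta / M.

(* The [Let] facts of this section are used implicitly: [lra] and [nra] find
   them in the context. *)
Let delta3 : 0 < delta ^ 3 <= 1.
Proof. by split; [apply: pow_lt; lra | rewrite -(pow1 3); apply: pow_incr; lra]. Qed.

(** The extreme case is [A = 0], [L = 2/3], [delta = 1], where [K] is 256/3. *)
Lemma offset_ge : 85 <= K.
Proof.
have E : K * delta ^ 3 = 64 * (A + 2) * L by rewrite /K; field; lra.
have : 85 <= K * delta ^ 3 by rewrite E; nra.
have : 0 <= K by apply: Rle_mult_inv_pos; [nra | lra].
nra.
Qed.

Hypothesis t_ge0 : 0 <= t.

Let M_ge : K <= M. Proof. by rewrite /M; lra. Qed.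

Let e_delta : e * delta = 4 / M.
Proof. by have := offset_ge => K85; rewrite /e; field; split; lra. Qed.

Let e_gt0 : 0 < e.
Proof.
have := offset_ge => K85; apply: Rdiv_lt_0_compat; last lra.
by apply: Rdiv_lt_0_compat; lra.
Qed.

(** The purpose of the offset: [e * delta] is [4 / M], and [M] is at least [K], which contains
    [(A + 2) * L]. *)
Lemma stepsize_le : 16 * (e * ((A + 2) * L)) <= delta ^ 2.
Proof.
have K85 := offset_ge.
have H : e * delta * K <= 4.
  rewrite e_delta; have -> : 4 / M * K = 4 * (K / M) by field; lra.
  suff : K / M <= 1 by lra.
  by apply: (Rmult_le_reg_r M); [lra | have -> : K / M * M = K by field; lra]; lra.
have E : e * delta * K = 64 * (e * ((A + 2) * L)) / delta ^ 2.
  by rewrite /K; field; lra.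
rewrite E in H.
have d2 : 0 < delta ^ 2 by apply: pow_lt; lra.
have := Rmult_le_compat_r _ _ _ (Rlt_le _ _ d2) H.
have -> : 64 * (e * ((A + 2) * L)) / delta ^ 2 * delta ^ 2 = 64 * (e * ((A + 2) * L)).
  by field; lra.
lra.
Qed.

Lemma stepsize_small : 0 <= e <= / 20.
Proof.
split; first lra.
have H := stepsize_le.
have : 4 / 3 <= (A + 2) * L by nra.
have : delta ^ 2 <= 1 by nra.
nra.
Qed.

(** [Y/M - Y/(M+1)] is less than [Y/M^2] for positive [Y], while the drift removes [3/2] of [Y/M^2].
    The surplus [Y / (2 M^2)] covers the noise once [Y] is twice its constant. *)
Lemma rate_arith Z Y q : 0 <= q -> Z <= Y / M -> 2 * (896 * c0 * q) <= Y ->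
  (1 - 3 / 2 / M) * Z + 896 * c0 * q / M ^ 2 <= Y / (M + 1).
Proof.
have K85 := offset_ge; have M0 : 0 < M by lra.
set Q := 896 * c0 * q => q0 ZY QY.
have Q0 : 0 <= Q.
  apply: Rmult_le_pos => //; apply: Rmult_le_pos; first lra.
  by apply: Rle_mult_inv_pos; [nra | lra].
have a0 : 0 <= 1 - 3 / 2 / M.
  suff : 3 / 2 / M <= 1 by lra.
  by apply: (Rmult_le_reg_r M); [lra | have -> : 3 / 2 / M * M = 3 / 2 by field; lra]; lra.
apply: (@Rle_trans _ ((1 - 3 / 2 / M) * (Y / M) + Y / 2 / M ^ 2)).
  apply: Rplus_le_compat; first exact: Rmult_le_compat_l.
  apply: Rmult_le_compat_r; last lra.
  by apply/Rlt_le/Rinv_0_lt_compat/pow_lt.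
have -> : Y / (M + 1) = (1 - 3 / 2 / M) * (Y / M) + Y / 2 / M ^ 2 + Y / (M ^ 2 * (M + 1)).
  by field; lra.
suff : 0 <= Y / (M ^ 2 * (M + 1)) by lra.
apply: Rle_mult_inv_pos; first lra.
by apply: Rmult_lt_0_compat; [apply: pow_lt | lra].
Qed.

Variables (p D B v : R).
Hypothesis p_bounds : 4 * L / delta <= p <= 4 * L / delta + 2.
Hypotheses (D_ge0 : 0 <= D) (D_le : D <= 4 / (4 - delta)) (B_A : 32 * B ^ 2 <= A).

Let D2 : D ^ 2 * (4 - delta) ^ 2 <= 16.
Proof.
have H : D * (4 - delta) <= 4.
  have E : 4 / (4 - delta) * (4 - delta) = 4 by field; lra.
  rewrite -[X in _ <= X]E.
  by apply: Rmult_le_compat_r; lra.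
have H0 : 0 <= D * (4 - delta) by apply: Rmult_le_pos; lra.
rewrite -Rpow_mult_distr; nra.
Qed.

Let p_ge0 : 0 <= p.
Proof.
have : 0 <= 4 * L / delta by apply: Rle_mult_inv_pos; lra.
by case: p_bounds; lra.
Qed.

(** Rounding [p] up costs [2 * delta], which [L >= 2/3] turns into at most [3 * delta * L]. *)
Let p_delta : p * delta <= (4 + 3 * delta) * L.
Proof.
have H : p * delta <= (4 * L / delta + 2) * delta by apply: Rmult_le_compat_r; lra.
have E : (4 * L / delta + 2) * delta = 4 * L + 2 * delta by field; lra.
have : 2 / 3 * delta <= L * delta by apply: Rmult_le_compat_r; lra.
lra.
Qed.

Lemma noise_coef_le : e * p * A * D ^ 2 <= (4 + 3 * delta) * delta / (4 - delta) ^ 2.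
Proof.
have s2 : 0 < (4 - delta) ^ 2 by apply: pow_lt; lra.
have H := stepsize_le.
have epA : e * p * A <= (4 + 3 * delta) * delta / 16.
  apply: (Rmult_le_reg_r delta); first lra.
  apply: (@Rle_trans _ (e * A * ((4 + 3 * delta) * L))).
    have -> : e * p * A * delta = e * A * (p * delta) by ring.
    by apply: Rmult_le_compat_l => //; nra.
  have H1 : e * A * L <= delta ^ 2 / 16.
    have : 0 <= e * L by nra.
    lra.
  have := Rmult_le_compat_l (4 + 3 * delta) _ _ ltac:(lra) H1; lra.
have D2' : D ^ 2 <= 16 / (4 - delta) ^ 2.
  apply: (Rmult_le_reg_r ((4 - delta) ^ 2)) => //.
  have -> : 16 / (4 - delta) ^ 2 * (4 - delta) ^ 2 = 16 by field; lra.
  exact: D2.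
apply: (@Rle_trans _ ((4 + 3 * delta) * delta / 16 * (16 / (4 - delta) ^ 2))).
  apply: Rmult_le_compat => //; last exact: pow2_ge_0.
  by apply: Rmult_le_pos => //; apply: Rmult_le_pos; lra.
by apply: Req_le; field; lra.
Qed.

(** Weighted AM-GM: [(a + b)^2 <= 4 a^2 + 4/3 b^2] with [a = 1 + 2v], [b = 2N], then
    [a^2 <= 3 (1 + 2 v^2)]. The weights favour a small coefficient of [N^2], the part that the drift
    must beat. *)
Lemma noise_sq_le N : 0 <= N -> 0 <= v ->
  (2 * (B * (1 + 2 * (v + N)))) ^ 2 <= A * (2 / 3 * N ^ 2 + 3 / 2 * (1 + 2 * v ^ 2)).
Proof.
move=> N0 v0.
have -> : (2 * (B * (1 + 2 * (v + N)))) ^ 2 = 32 * B ^ 2 * ((1 + 2 * (v + N)) ^ 2 / 8).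
  by field.
have sq0 := pow2_ge_0 (1 + 2 * (v + N)).
apply: (@Rle_trans _ (A * ((1 + 2 * (v + N)) ^ 2 / 8))).
  by apply: Rmult_le_compat_r => //; lra.
apply: Rmult_le_compat_l => //.
have := pow2_ge_0 (2 * N / 3 - (1 + 2 * v)); have := pow2_ge_0 (1 - v); nra.
Qed.

Lemma one_step_arith N : 0 <= N -> 0 <= v ->
  ((1 - e * (1 - (1 - delta) * D)) * N) ^ 2 +
    3 * p * D ^ 2 * (e * (2 * (B * (1 + 2 * (v + N))))) ^ 2 <=
  (1 - 3 / 2 / M) * N ^ 2 + 896 * c0 * (1 + 2 * v ^ 2) / M ^ 2.
Proof.
move=> N0 v0; set r := 1 - (1 - delta) * D; set s := 4 - delta.
have K85 := offset_ge; have M0 : 0 < M by lra.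
have s34 : 3 <= s <= 4 by rewrite /s; lra.
have r_le1 : r <= 1.
  have : 0 <= (1 - delta) * D by apply: Rmult_le_pos; lra.
  rewrite /r; lra.
have r_ge : 3 * delta / s <= r.
  have : (1 - delta) * D <= (1 - delta) * (4 / s) by apply: Rmult_le_compat_l; rewrite /s; lra.
  have -> : 3 * delta / s = 1 - (1 - delta) * (4 / s) by rewrite /s; field; lra.
  rewrite /r; lra.
have r0 : 0 <= r.
  by apply: Rle_trans r_ge; apply: Rle_mult_inv_pos; lra.
have e20 := stepsize_small.
(* [(1 - x)^2 <= 1 - 1.95 x] for [0 <= x <= 1/20]. *)
have drift : (1 - e * r) ^ 2 <= 1 - 195 / 100 * (e * (3 * delta / s)).
  have H1 : e * (3 * delta / s) <= e * r by apply: Rmult_le_compat_l => //; lra.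
  have H2 : 0 <= e * r <= / 20 by nra.
  nra.
have noise := noise_sq_le N0 v0.
have noise' : 3 * p * D ^ 2 * (e * (2 * (B * (1 + 2 * (v + N))))) ^ 2 <=
   e * (e * p * A * D ^ 2) * (2 * N ^ 2) +
   e ^ 2 * p * A * D ^ 2 * (9 / 2 * (1 + 2 * v ^ 2)).
  rewrite (Rpow_mult_distr e).
  have C0 : 0 <= 3 * p * D ^ 2 * e ^ 2.
    by apply: Rmult_le_pos (pow2_ge_0 _); apply: Rmult_le_pos (pow2_ge_0 _); lra.
  have := Rmult_le_compat_l _ _ _ C0 noise; lra.
have coefN : (1 - e * r) ^ 2 + e * (e * p * A * D ^ 2) * 2 <= 1 - 3 / 2 / M.
  have H1 : e * (e * p * A * D ^ 2) <= e * ((4 + 3 * delta) * delta / s ^ 2).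
    by apply: Rmult_le_compat_l; [lra | exact: noise_coef_le].
  have E : 1 - 195 / 100 * (e * (3 * delta / s)) + e * ((4 + 3 * delta) * delta / s ^ 2) * 2
     = 1 - e * delta * (585 / 100 / s - 2 * (16 - 3 * s) / s ^ 2).
    by rewrite /s; field; lra.
  (* The value 3/8 is what turns [e * delta = 4 / M] into [3/2 / M]. At [s = 3], that is
     [delta = 1], the cleared inequality reads 3.375 <= 3.55, so the factor 1.95 in [drift] has
     little to spare. *)
  have H2 : 3 / 8 <= 585 / 100 / s - 2 * (16 - 3 * s) / s ^ 2.
    have s2 : 0 < s ^ 2 by apply: pow_lt; lra.
    apply: (Rmult_le_reg_r (s ^ 2)) => //.
    have -> : (585 / 100 / s - 2 * (16 - 3 * s) / s ^ 2) * s ^ 2 =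
      585 / 100 * s - 2 * (16 - 3 * s) by field; lra.
    nra.
  have H3 : 0 < e * delta by apply: Rmult_lt_0_compat; lra.
  have H4 : e * delta * (3 / 8) = 3 / 2 / M by rewrite e_delta; field; lra.
  have := Rmult_le_compat_l _ _ _ (Rlt_le _ _ H3) H2; lra.
(* 896 is [72 * 7 * 16/9]: 72 from [9/2 * 4^2], then [p * delta <= 7 * L] and [D ^ 2 <= 16 / 9]. *)
have coefQ : e ^ 2 * p * A * D ^ 2 * (9 / 2) <= 896 * c0 / M ^ 2.
  have -> : e ^ 2 * p * A * D ^ 2 * (9 / 2) = 72 * (p * delta) * A * D ^ 2 / (delta ^ 3 * M ^ 2).
    by rewrite /e; field; lra.
  have -> : 896 * c0 / M ^ 2 = 896 * (A + 2) * L / (delta ^ 3 * M ^ 2).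
    by rewrite /c0; field; lra.
  apply: Rmult_le_compat_r.
    by apply/Rlt_le/Rinv_0_lt_compat; apply: Rmult_lt_0_compat; [lra | apply: pow_lt].
  have D9 : D ^ 2 <= 16 / 9.
    have : D ^ 2 * 9 <= D ^ 2 * s ^ 2 by apply: Rmult_le_compat_l; [exact: pow2_ge_0 | nra].
    have := D2; rewrite -/s; lra.
  have p7 : p * delta <= 7 * L by nra.
  have pA : 0 <= p * delta * A by apply: Rmult_le_pos => //; apply: Rmult_le_pos; lra.
  have H1 : p * delta * A * D ^ 2 <= 7 * L * A * (16 / 9).
    apply: Rmult_le_compat => //; first exact: pow2_ge_0.
    by apply: Rmult_le_compat_r.
  lra.
have Q0 : 0 <= 1 + 2 * v ^ 2 by have := pow2_ge_0 v; lra.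
have N2 := pow2_ge_0 N.
rewrite (Rpow_mult_distr _ N).
have X1 := Rmult_le_compat_r _ _ _ N2 coefN.
have X2 := Rmult_le_compat_r _ _ _ Q0 coefQ.
rewrite /Rdiv in X1 X2 noise' *; lra.
Qed.

End StepArithmetic.

Theorem theorem3 (S Act : finType) (P : Act -> S -> S -> R) (Rw : S -> Act -> R)
    (beta : R) (pi pi' : S -> Act -> R) (rhobar cbar : R) (n : nat)
    (kc krho : R) (Vrho : S -> R) (V0 : S -> R) :
  (1 < #|S|)%nat ->
  is_transition P ->
  (forall s a, 0 <= Rw s a <= 1)%R ->
  (0 < beta < 1)%R ->
  is_policy pi -> is_policy pi' ->
  (forall s a, 0 < pi s a -> 0 < pi' s a)%R ->
  (0 < cbar <= rhobar)%R ->
  (1 <= n)%nat ->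
  is_min_over_states (exp_trunc_ratio pi pi' cbar) kc ->
  is_min_over_states (exp_trunc_ratio pi pi' rhobar) krho ->
  is_value_function P Rw beta (pi_trunc pi pi' rhobar) Vrho ->
  let gamma := gamma_factor beta kc krho n in
  let A := noise_const beta cbar rhobar n in
  let eps := (4 / (1 - gamma))%R in
  let K := (64 * (A + 2) * ln (INR #|S|) / (1 - gamma) ^ 3)%R in
  let epsk := fun k : nat => (eps / (INR k + K))%R in
  forall k : nat,
    (vtrace_exp P Rw pi pi' beta cbar rhobar n epsk V0 k
       (fun V => sup_norm (fun s => V s - Vrho s) ^ 2)
     <= 1024 * exp 2 *
        (sup_norm (fun s => V0 s - Vrho s) ^ 2 + 2 * sup_norm Vrho ^ 2 + 1) *
        ((A + 2) * ln (INR #|S|) / (1 - gamma) ^ 3) * (1 / (INR k + K)))%R.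
Proof.
move=> S1 P_tr Rw01 beta01 pi_pol pi'_pol supp cr n1 kc_min krho_min HV gamma A eps K epsk k.
have [s0 _] : exists s0 : S, s0 \in S by apply/card_gt0P; apply: ltnW.
have S0 : (0 < #|S|)%nat := ltnW S1.
have W_fix := value_function_trunc_fixpoint P_tr pi_pol pi'_pol supp
  (Rlt_le_trans _ _ _ cr.1 cr.2) HV.
have g01 : 0 <= gamma <= 1 :=
  gamma_factor01 beta01 pi_pol pi'_pol supp cr kc_min krho_min n.
have g1 : gamma < 1 :=
  gamma_factor_lt1 beta01 pi_pol pi'_pol supp cr kc_min krho_min n1.
pose delta := 1 - gamma; pose L := ln (INR #|S|).
have d01 : 0 < delta <= 1 by rewrite /delta; lra.
(* Two states keep [ln |S|], and with it [K], away from 0; otherwise the first stepsize would divide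
   by 0. *)
have L_ge : 2 / 3 <= L.
  apply: Rle_trans ln2_ge _; apply: ln_le; first lra.
  by apply: (le_INR 2); apply/leP.
have [m [m_le m_gt]] : exists m, INR m <= 2 * L / delta < INR m + 1.
  by apply: nat_floor_ex; apply: Rle_mult_inv_pos; lra.
pose p := m.+1.*2; pose D := dimroot S p.
have p0 : (0 < p)%nat by rewrite /p doubleS.
have INRp : INR p = 2 * (INR m + 1) by rewrite /p -mul2n mult_INR (S_INR m).
have p_bounds : 4 * L / delta <= INR p <= 4 * L / delta + 2.
  have -> : 4 * L / delta = 2 * (2 * L / delta) by field; lra.
  by rewrite INRp; lra.
have D0 : 0 <= D := dimroot_ge0 S p.
have D_le : D <= 4 / (4 - delta) := dimroot_le S0 p0 d01 p_bounds.1.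
pose B := rhobar * geom_sum (beta * cbar) n; pose v := sup_norm Vrho.
have B_A : 32 * B ^ 2 <= A by apply: noise_const_ge; nra.
have A0 : 0 <= A by have := pow2_ge_0 B; lra.
have v0 : 0 <= v := sup_norm_ge0 Vrho.
pose c0 := (A + 2) * L / delta ^ 3.
have d3 : 0 < delta ^ 3 by apply: pow_lt; lra.
have c0_ge0 : 0 <= c0 by apply: Rle_mult_inv_pos => //; nra.
have KE : K = 64 * c0 by rewrite /K /c0 -/L -/delta; field; lra.
have K85 : 85 <= K := offset_ge d01 A0 L_ge.
pose X0 := sup_norm (fun s => V0 s - Vrho s).
have v2 := pow2_ge_0 v; have X2 := pow2_ge_0 X0.
pose Y := 1024 * exp 2 * (X0 ^ 2 + 2 * v ^ 2 + 1) * c0.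
have e4 : 4 <= exp 2.
  have -> : 2 = INR 2 * 1 by rewrite /=; ring.
  rewrite exp_INR_mul; have := exp_ineq1_le 1; nra.
(* Of [exp 2] only the factor 4 is kept. 4096 exceeds both the [64 * 16/9] needed at time 0 and the
   [2 * 896] needed by [rate_arith]. *)
have Y_ge : 4096 * (X0 ^ 2 + (1 + 2 * v ^ 2)) * c0 <= Y.
  rewrite /Y; apply: Rmult_le_compat_r => //; nra.
pose Z j := vtrace_exp P Rw pi pi' beta cbar rhobar n epsk V0 j
  (fun V => pnorm p (fun s => V s - Vrho s) ^ 2).
have sup_le_Z : vtrace_exp P Rw pi pi' beta cbar rhobar n epsk V0 k
    (fun V => sup_norm (fun s => V s - Vrho s) ^ 2) <= Z k.
  apply: vtrace_exp_le => // V; apply: pow_incr; split; first exact: sup_norm_ge0.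
  by apply: sup_norm_le => [|s]; [apply: pnorm_ge0 | apply: (Rabs_le_pnorm p0 (fun s => V s - Vrho s))].
apply: Rle_trans sup_le_Z _.
have -> : 1024 * exp 2 * (sup_norm (fun s => V0 s - Vrho s) ^ 2 + 2 * sup_norm Vrho ^ 2 + 1) *
   ((A + 2) * ln (INR #|S|) / (1 - gamma) ^ 3) * (1 / (INR k + K)) = Y / (INR k + K).
  by rewrite /Y /c0 /X0 /v /L /delta /Rdiv; ring.
elim: k => [|k IHk].
  rewrite Rplus_0_l /Z /=.
  have N0 : pnorm p (fun s => V0 s - Vrho s) <= D * X0.
    apply: pnorm_le_sup => //; first exact: sup_norm_ge0.
    exact: Rabs_le_sup_norm.
  have D43 : D <= 4 / 3.
    apply: Rle_trans D_le _; apply: Rmult_le_compat_l; first lra.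
    by apply: Rinv_le_contravar; lra.
  have NX : pnorm p (fun s => V0 s - Vrho s) ^ 2 <= 16 / 9 * X0 ^ 2.
    have -> : 16 / 9 * X0 ^ 2 = (4 / 3 * X0) ^ 2 by field.
    apply: pow_incr; split; first exact: pnorm_ge0.
    by apply: Rle_trans N0 _; apply: Rmult_le_compat_r => //; apply: sup_norm_ge0.
  apply: Rle_trans NX _.
  apply: (Rmult_le_reg_r K); first lra.
  have -> : Y / K * K = Y by field; lra.
  by rewrite KE; have : 0 <= X0 ^ 2 * c0 by [nra]; have : 0 <= v ^ 2 * c0 by [nra]; lra.
have q0 : 0 <= 1 + 2 * v ^ 2 by lra.
have t0 := pos_INR k; pose M := INR k + K.
have -> : INR k.+1 + K = M + 1 by rewrite S_INR /M; ring.
apply: Rle_trans (rate_arith d01 A0 L_ge t0 q0 IHk _); last first.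
  apply: Rle_trans Y_ge; rewrite -/c0.
  by have : 0 <= X0 ^ 2 * c0 by [nra]; have : 0 <= v ^ 2 * c0 by [nra]; lra.
pose Phi V := pnorm p (fun s => V s - Vrho s) ^ 2.
(* The one-step bound holds for every current iterate [V] and is affine in [Phi V], so averaging
   over time [k] gives a recursion for [Z]. *)
have aff := vtrace_exp_affine Rw beta pi rhobar cbar P_tr pi'_pol n epsk V0 k Phi
  (1 - 3 / 2 / M) (896 * c0 * (1 + 2 * v ^ 2) / M ^ 2) s0.
apply: Rle_trans aff.
rewrite /Z [vtrace_exp _ _ _ _ _ _ _ _ _ _ k.+1 _]/=.
apply: vtrace_exp_le => // V; pose N := pnorm p (fun s => V s - Vrho s).
(* The size of the current iterate is charged to the Lyapunov function, which replaces a bound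
   uniform in [k]. *)
have VN s : Rabs (V s) <= v + N.
  have -> : V s = Vrho s + (V s - Vrho s) by ring.
  apply: Rle_trans (Rabs_triang _ _) _; apply: Rplus_le_compat; first exact: Rabs_le_sup_norm.
  exact: (Rabs_le_pnorm p0 (fun s => V s - Vrho s)).
have [e0 e20] := stepsize_small d01 A0 L_ge t0.
have e01 : 0 <= epsk k <= 1 by split; [exact: e0 | apply: Rle_trans e20 _; lra].
apply: Rle_trans (step_exp_pnorm_le P_tr Rw01 beta01 pi_pol pi'_pol supp cr
  kc_min krho_min W_fix n m s0 e01 VN) _.
have := one_step_arith d01 A0 L_ge t0 p_bounds D0 D_le B_A (pnorm_ge0 p (fun s => V s - Vrho s)) v0.
have -> : 1 - delta = gamma_factor beta kc krho n by rewrite /delta -/gamma; ring.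
exact.
Qed.
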